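(* Given $\alpha>0$, a real number $p\ge1$, and a positive function $\gamma\in C_0(\mathbb R_+)$, there exist a Banach space $X_\alpha$, a bounded $C_0$-semigroup $(T(t))_{t\ge0}$ on $X_\alpha$ with generator $A$, and a vector $f\in X_\alpha$, such that (a) $\sigma(A)\cap i\mathbb R$ is empty and $\|R(is,A)\|_{\mathcal L(X_\alpha)}=O(|s|^\alpha)$ as $|s|\to\infty$, (b) $\displaystyle\int_0^\infty\|T(t)f\|_{X_\alpha}^p\,dt<\infty$, (c) $\displaystyle\int_0^\infty\|T(t)A^{-1}f\|_{X_\alpha}^p\Big(\frac{t}{\gamma(t)\log(t+2)}\Big)^{p/\alpha}\,dt=\infty$.
   Context: $\mathbb R_+=[0,\infty)$; $C_0(\mathbb R_+)$ is the space of continuous functions on $\mathbb R_+$ tending to $0$ at infinity. $R(\lambda,A)=(\lambda-A)^{-1}$, $\mathcal L(X_\alpha)$ is the space of bounded linear operators on $X_\alpha$, and a semigroup is bounded if $\sup_{t\ge0}\|T(t)\|<\infty$. Banach spaces are complex. *)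

(* Defs.v *)
From HB Require Import structures.
From mathcomp Require Import all_boot all_order all_algebra.
From mathcomp Require Import all_classical all_reals all_analysis.
From mathcomp Require Import complex.
Set Implicit Arguments.
Unset Strict Implicit.
Unset Printing Implicit Defensive.
Import Order.TTheory GRing.Theory Num.Theory numFieldNormedType.Exports.

Local Open Scope classical_set_scope.
Local Open Scope ring_scope.
Local Open Scope complex_scope.

Section Operators.
Context {R : realType} {X : completeNormedModType R[i]}.

(* The norm of a normed module over R[i] takes its values in R[i]; they are
   nonnegative, hence have zero imaginary part. *)
Definition rnorm (x : X) : R := complex.Re `|x|.

(* Extended-real valued, so that an unbounded operator has norm +oo. *)
Definition opnorm (L : X -> X) : \bar R :=
  ereal_sup [set (rnorm (L x))%:E | x in [set x | rnorm x <= 1]].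

(* A possibly unbounded operator; [app] is meaningful on [dom] only. *)
Record operator := Operator { dom : set X ; app :> X -> X }.

(* The inverse of an operator that is a bijection from its domain onto X. *)
Definition inverse (A : operator) : X -> X :=
  fun y => xget 0 [set x | dom A x /\ A x = y].

Definition shift (z : R[i]) (A : operator) : operator :=
  Operator (dom A) (fun x => z *: x - A x).

Definition resolvent (z : R[i]) (A : operator) : X -> X := inverse (shift z A).

Definition resolvent_set (A : operator) : set R[i] :=
  [set z | set_bij (dom A) setT (shift z A) /\
           (opnorm (resolvent z A) < +oo)%E].

Definition spectrum (A : operator) : set R[i] := ~` resolvent_set A.

(* Only the values T t with 0 <= t matter. *)
Record C0_semigroup (T : R -> {linear X -> X}) : Prop := {
  semigroup_bounded_op : forall t : R, 0 <= t -> (opnorm (T t) < +oo)%E ;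
  semigroup0 : forall x, T 0 x = x ;
  semigroupD : forall (s t : R) x, 0 <= s -> 0 <= t -> T (s + t) x = T s (T t x) ;
  semigroup_cvg : forall x, T t x @[t --> 0^'+] --> x
}.

Definition bounded_semigroup (T : R -> {linear X -> X}) : Prop :=
  exists M : R, forall t : R, 0 <= t -> (opnorm (T t) <= M%:E)%E.

Definition generator (T : R -> {linear X -> X}) : operator :=
  let q x h := (h^-1)%:C *: (T h x - x) in
  Operator [set x | cvg (q x h @[h --> 0^'+])]
           (fun x => lim (q x h @[h --> 0^'+])).

End Operators.

Definition imaginary_axis {R : realType} : set R[i] :=
  [set z | complex.Re z = 0].

(* Only the restriction of g to [0, +oo[ matters. *)
Definition C0_Rplus {R : realType} (g : R -> R) : Prop :=
  {within `[0, +oo[, continuous g} /\ g t @[t --> +oo] --> 0.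

(* Main.v *)
Require Import Defs.
From HB Require Import structures.
From mathcomp Require Import all_boot all_order all_algebra.
From mathcomp Require Import all_classical all_reals all_analysis.
From mathcomp Require Import measurable_realfun complex.
From mathcomp Require Import zify ring lra.
Set Implicit Arguments.
Unset Strict Implicit.
Unset Printing Implicit Defensive.
Import Order.TTheory GRing.Theory Num.Theory numFieldNormedType.Exports.
Local Open Scope classical_set_scope.
Local Open Scope ring_scope.
Local Open Scope complex_scope.

(** The space is a c_0-sum of finite-dimensional blocks, and each block realizes,
at one frequency [N], the loss of a logarithm between the growth [M = N^alpha] of
the resolvent and the decay of the semigroup.

Inside a block the vectors are polynomials [v] modulo ['X^K], and the semigroup is
[e^(iNt) e^(t('X - 1))]: multiplication by ['X] is a shift, and the exponential
moves the coefficients to the right at speed one, with the fluctuations of a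
Poisson process. The norm is the sum of [max_k |v_k|] and of
[M^-1 * sum_k (1 + M^-1)^(K-k) |v_k|].

- Both terms are contracted, and the second one decays like [e^(-t/(M+1))], because
  the shift decreases the weights by a constant factor. As the first term is at most
  [M] times the second one, the semigroup is bounded by
  [min (1, (M+1) e^(-t/(M+1)))]: it need not decay before a time [M ln M]
  ([bnorm_sg_sym_decay], [decay_le_exp]).
- At the imaginary point [is] the resolvent is the Neumann series of
  [(1 + i(s-N) - 'X)^-1]. Its coefficients have modulus at most one, so it maps the
  weighted sum norm to the maximum norm with constant [M], and its norm is at most
  [2M + 1] ([bnorm_res_sym]): no logarithm appears. When [|s - N| >= 2] the series is
  absolutely summable and the norm is at most one, because the shift is bounded. With
  [M = N^alpha] the resolvent of the sum is therefore [O(|s|^alpha)]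
  ([res_mult_subproof]).
- Let [K] be a small multiple of [M ln M]. A bump of height one and of width [W], with
  [sqrt K] much smaller than [W] and [W] much smaller than [M], placed at the left end
  of the block has norm at most 2, since all the weights are at most a small power of
  [M] divided by [M]. It is transported through the whole block, and the Poisson
  fluctuations, of size [sqrt K], do not destroy it: by Chebyshev's inequality its
  maximum is at least [1/2] for times between [K/4] and [K/2] ([poisson_bump_ge],
  [maxnorm_bump_scale]).

In such a block, for [t] of order [M ln M], the quantity [t / ln t] is of order
[M = N^alpha], while applying the inverse of the generator costs a factor of order
[N]. Hence [|T(t) A^-1 f| (t / ln t)^(1/alpha)] and [|T(t) f|] have the same order of
magnitude, and the factor [1 / gamma(t)] is a gain. The vector [f] combines the bumps
of a sequence of blocks, with coefficients whose p-th powers are [2^-n] divided by the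
lifetime of the block. The integral (b) is then bounded by a geometric series, and
the frequencies are chosen so high that [gamma] is small enough during the life of the
[n]-th block for the integral (c) over that life to exceed [n].

The resolvent and the generator of the sum act blockwise: difference quotients converge
in each block by a second order Taylor estimate, and in the sum by domination
([c0_dominated_cvg], [generatorP]). *)

(** * The modulus as a real number *)

Section Modulus.
Context {R : realType}.
Implicit Types (z u : R[i]) (x : R).

Definition cabs z : R := complex.Re `|z|.

Lemma cabsE z : (cabs z)%:C = `|z|.
Proof. by rewrite /cabs normc_def. Qed.

Lemma cabs_ge0 z : 0 <= cabs z.
Proof. by rewrite -lecR cabsE normr_ge0. Qed.

Lemma cabs0 : cabs 0 = 0.
Proof. by rewrite /cabs normr0. Qed.

Lemma cabs1 : cabs 1 = 1.
Proof. by rewrite /cabs normr1. Qed.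

Lemma cabsM z u : cabs (z * u) = cabs z * cabs u.
Proof. by apply: complexI; rewrite rmorphM/= !cabsE normrM. Qed.

Lemma cabsX z n : cabs (z ^+ n) = cabs z ^+ n.
Proof. by apply: complexI; rewrite rmorphXn/= !cabsE normrX. Qed.

Lemma cabsV z : cabs z^-1 = (cabs z)^-1.
Proof. by apply: complexI; rewrite fmorphV/= !cabsE normfV. Qed.

Lemma cabsN z : cabs (- z) = cabs z.
Proof. by rewrite /cabs normrN. Qed.

Lemma cabsD z u : cabs (z + u) <= cabs z + cabs u.
Proof. by rewrite -lecR rmorphD/= !cabsE ler_normD. Qed.

Lemma cabs_real x : cabs x%:C = `|x|.
Proof. by rewrite /cabs normc_def/= expr0n addr0 sqrtr_sqr. Qed.

Lemma cabs_eq0 z : cabs z = 0 -> z = 0.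
Proof. by move=> z0; apply/eqP; rewrite -normr_eq0 -cabsE z0. Qed.

Lemma cabs_ReIm x y : cabs (x +i* y) <= `|x| + `|y|.
Proof.
have i1 : cabs 'i%C = 1 :> R by rewrite /cabs normc_def/= expr0n expr1n add0r sqrtr1.
by rewrite [x +i* y]complexE (le_trans (cabsD _ _))// cabsM i1 mul1r !cabs_real.
Qed.

Lemma Re_le_cabs z : `|complex.Re z| <= cabs z.
Proof. by have := normc_ge_Re z; rewrite -cabsE lecR. Qed.

Lemma Im_le_cabs z : `|complex.Im z| <= cabs z.
Proof.
by rewrite /cabs normc_def/= -sqrtr_sqr ler_sqrt ?addr_ge0 ?sqr_ge0// lerDr sqr_ge0.
Qed.

End Modulus.

(** * Seminorms on polynomials modulo a power of the variable *)

Section TakePoly.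
Context {F : comNzRingType}.
Implicit Types p q : {poly F}.

Lemma take_poly_mull K p q : take_poly K (take_poly K p * q) = take_poly K (p * q).
Proof.
rewrite -[in RHS](poly_take_drop K p) mulrDl take_polyD mulrAC.
by rewrite take_polyMXn_0 addr0.
Qed.

Lemma take_poly_mulr K p q : take_poly K (p * take_poly K q) = take_poly K (p * q).
Proof. by rewrite mulrC take_poly_mull mulrC. Qed.

Lemma take_polyB K p q : take_poly K (p - q) = take_poly K p - take_poly K q.
Proof. exact: raddfB. Qed.

End TakePoly.

Section Seminorms.
Context {R : realType}.
Variable K : nat.
Implicit Types (v c : {poly R[i]}) (w : nat -> R) (q : {poly R[i]} -> R).

(** The last clause makes [q] a seminorm on polynomials modulo ['X^K]. *)
Definition seminorm q :=
  [/\ forall u v, q (u + v) <= q u + q v, forall z v, q (z *: v) = cabs z * q v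
   & forall v, q (take_poly K v) = q v].

Section SeminormTheory.
Variable q : {poly R[i]} -> R.
Hypothesis hq : seminorm q.

Lemma seminorm0 : q 0 = 0.
Proof. by case: hq => _ h _; rewrite -(scale0r 0) h cabs0 mul0r. Qed.

Lemma seminormN v : q (- v) = q v.
Proof. by case: hq => _ h _; rewrite -scaleN1r h cabsN cabs1 mul1r. Qed.

Lemma seminorm_ge0 v : 0 <= q v.
Proof.
case: (hq) => hD _ _; have := hD v (- v).
by rewrite subrr seminorm0 seminormN -mulr2n pmulrn_lge0.
Qed.

Lemma seminorm_sum I (r : seq I) (P : pred I) (F : I -> {poly R[i]}) :
  q (\sum_(i <- r | P i) F i) <= \sum_(i <- r | P i) q (F i).
Proof.
elim/big_ind2: _ => [|z1 x1 z2 x2 h1 h2|//]; first by rewrite seminorm0.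
by case: hq => hD _ _; rewrite (le_trans (hD _ _))// lerD.
Qed.

(** Multiplication by [c] is the combination of the shifts ['X^j] with
coefficients [c`_j]; every operator bound below comes from this inequality. *)
Lemma seminorm_mul c v :
  q (c * v) <= \sum_(j < K) cabs c`_j * q ('X^j * v).
Proof.
case: (hq) => _ hZ hT; rewrite -hT -take_poly_mull hT.
rewrite /take_poly poly_def mulr_suml (le_trans (seminorm_sum _ _ _))//.
by apply: ler_sum => j _; rewrite -scalerAl hZ.
Qed.

End SeminormTheory.

Definition maxnorm v : R := \big[Num.max/0]_(k < K) cabs v`_k.

Definition wnorm w v : R := \sum_(k < K) `|w k| * cabs v`_k.

(** In the maximum norm alone the resolvent would be as large as [K]; in the weighted
norm alone the semigroup would decay exponentially from the start. In the sum, a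
vector whose maximum norm dominates keeps its size until the decay of the weighted
norm has made up for the ratio of the two terms. *)
Definition bnorm w v : R := maxnorm v + wnorm w v.

Lemma maxnorm_coef v k : (k < K)%N -> cabs v`_k <= maxnorm v.
Proof. by move=> kK; exact: (le_bigmax _ (fun k : 'I_K => cabs v`_k) (Ordinal kK)). Qed.

Lemma maxnorm_le v x : 0 <= x -> (forall k, (k < K)%N -> cabs v`_k <= x) ->
  maxnorm v <= x.
Proof. by move=> x0 h; apply/bigmax_leP; split=> // k _; exact: h. Qed.

Lemma maxnorm_ge0 v : 0 <= maxnorm v.
Proof. exact: bigmax_ge_id. Qed.

Lemma seminorm_maxnorm : seminorm maxnorm.
Proof.
split.
- move=> u v; apply: maxnorm_le; first by rewrite addr_ge0 ?maxnorm_ge0.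
  by move=> k kK; rewrite coefD (le_trans (cabsD _ _))// lerD ?maxnorm_coef.
- move=> z v; have le_scale z' v' : maxnorm (z' *: v') <= cabs z' * maxnorm v'.
    apply: maxnorm_le => [|k kK]; first by rewrite mulr_ge0 ?cabs_ge0 ?maxnorm_ge0.
    by rewrite coefZ cabsM ler_wpM2l ?cabs_ge0 ?maxnorm_coef.
  apply/le_anti; rewrite le_scale/=.
  have [->|z0] := eqVneq z 0; first by rewrite cabs0 mul0r maxnorm_ge0.
  have z1 : 0 < cabs z.
    by rewrite lt_neqAle cabs_ge0 andbT eq_sym; apply: contra_neq z0 => /cabs_eq0.
  rewrite -ler_pdivlMl// -cabsV -{1}[v](scalerK z0) ?unitfE//.
- by move=> v; apply: eq_bigr => k _; rewrite coef_take_poly ltn_ord.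
Qed.

Lemma seminorm_wnorm w : seminorm (wnorm w).
Proof.
split.
- move=> u v; rewrite -big_split/=; apply: ler_sum => k _.
  by rewrite coefD -mulrDr ler_wpM2l// cabsD.
- move=> z v; rewrite mulr_sumr; apply: eq_bigr => k _.
  by rewrite coefZ cabsM mulrCA.
- by move=> v; apply: eq_bigr => k _; rewrite coef_take_poly ltn_ord.
Qed.

Lemma seminorm_bnorm w : seminorm (bnorm w).
Proof.
have [aD aZ aT] := seminorm_maxnorm; have [bD bZ bT] := seminorm_wnorm w.
split=> [u v|z v|v]; rewrite /bnorm.
- by rewrite addrACA lerD.
- by rewrite aZ bZ mulrDr.
- by rewrite aT bT.
Qed.

Lemma wnorm_ge0 w v : 0 <= wnorm w v.
Proof. exact: seminorm_ge0 (seminorm_wnorm w) _. Qed.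

Lemma bnorm_ge0 w v : 0 <= bnorm w v.
Proof. exact: seminorm_ge0 (seminorm_bnorm w) _. Qed.

Lemma maxnorm_le_bnorm w v : maxnorm v <= bnorm w v.
Proof. by rewrite lerDl wnorm_ge0. Qed.

Lemma wnorm_le_bnorm w v : wnorm w v <= bnorm w v.
Proof. by rewrite lerDr maxnorm_ge0. Qed.

Lemma bnorm_coef w v k : (k < K)%N -> cabs v`_k <= bnorm w v.
Proof. by move=> kK; rewrite (le_trans (maxnorm_coef _ kK)) ?maxnorm_le_bnorm. Qed.

Lemma bnorm_eq0 w v : (size v <= K)%N -> bnorm w v = 0 -> v = 0.
Proof.
move=> sv v0; apply/polyP => k; rewrite coef0; have [kK|Kk] := ltnP k K.
  by apply: cabs_eq0; apply/le_anti; rewrite cabs_ge0 -v0 bnorm_coef.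
by rewrite nth_default// (leq_trans sv).
Qed.

Lemma bnorm_le_coef w v x : 0 <= x -> (forall k, (k < K)%N -> cabs v`_k <= x) ->
  bnorm w v <= x * (1 + \sum_(k < K) `|w k|).
Proof.
move=> x0 h; rewrite mulrDr mulr1 lerD ?maxnorm_le// mulr_sumr ler_sum// => k _.
by rewrite mulrC ler_wpM2r// h.
Qed.

(** Multiplication by ['X] moves every coefficient to a place where the weight
is multiplied by at most [r]; this is the only source of decay in time. *)
Lemma wnorm_shift w r j v : 0 <= r ->
  (forall i k, (i + k < K)%N -> `|w (k + i)%N| <= r ^+ k * `|w i|) ->
  wnorm w ('X^j * v) <= r ^+ j * wnorm w v.
Proof.
move=> r0 hw; rewrite /wnorm mulr_sumr.
have -> : \sum_(k < K) `|w k| * cabs ('X^j * v)`_k =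
    \sum_(j <= k < K) `|w k| * cabs v`_(k - j).
  rewrite big_geq_mkord [RHS]big_mkcond/=; apply: eq_bigr => k _.
  by rewrite coefXnM; case: ltnP => //; rewrite cabs0 mulr0.
rewrite -{1}(add0n j) big_addn big_mkord.
rewrite (@big_ord_widen _ _ _ (K - j) K (fun i => `|w (i + j)%N| * cabs v`_(i + j - j)))
  ?leq_subr//.
rewrite big_mkcond/=; apply: ler_sum => i _; case: ifPn => [iK|_].
  by rewrite addnK mulrA ler_wpM2r ?cabs_ge0// addnC hw//; lia.
by rewrite !mulr_ge0// ?exprn_ge0// cabs_ge0.
Qed.

Lemma maxnorm_shift j v : maxnorm ('X^j * v) <= maxnorm v.
Proof.
apply: maxnorm_le => [|k kK]; first exact: maxnorm_ge0.
rewrite coefXnM; case: ltnP => jk; first by rewrite cabs0 maxnorm_ge0.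
by rewrite maxnorm_coef// (leq_ltn_trans (leq_subr _ _)).
Qed.

(** For [r = 1] this bounds the action of [c] in every norm contracted by the shift; for
[r < 1] it also takes advantage of the decrease of the weights. *)
Definition l1norm r c : R := \sum_(j < K) cabs c`_j * r ^+ j.

Lemma wnorm_mul w r c v : 0 <= r ->
  (forall i k, (i + k < K)%N -> `|w (k + i)%N| <= r ^+ k * `|w i|) ->
  wnorm w (c * v) <= l1norm r c * wnorm w v.
Proof.
move=> r0 hw; rewrite (le_trans (seminorm_mul (seminorm_wnorm w) _ _))//.
rewrite mulr_suml ler_sum// => j _.
by rewrite -mulrA ler_wpM2l ?cabs_ge0// wnorm_shift.
Qed.

Lemma maxnorm_mul c v : maxnorm (c * v) <= l1norm 1 c * maxnorm v.
Proof.
rewrite (le_trans (seminorm_mul seminorm_maxnorm _ _))//.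
rewrite mulr_suml ler_sum// => j _.
by rewrite expr1n mulr1 ler_wpM2l ?cabs_ge0// maxnorm_shift.
Qed.

(** The roles of the two factors are exchanged: a symbol with bounded coefficients
maps the sum norm to the maximum norm with a constant independent of [K]. *)
Lemma maxnorm_mul_max c v : maxnorm (c * v) <= maxnorm c * \sum_(k < K) cabs v`_k.
Proof.
rewrite mulrC (le_trans (seminorm_mul seminorm_maxnorm _ _))//.
rewrite mulr_sumr ler_sum// => j _.
by rewrite mulrC ler_wpM2r ?cabs_ge0// maxnorm_shift.
Qed.

Lemma bnorm_mul w c v :
  (forall i k, (i + k < K)%N -> `|w (k + i)%N| <= `|w i|) ->
  bnorm w (c * v) <= l1norm 1 c * bnorm w v.
Proof.
move=> hw; rewrite mulrDr lerD ?maxnorm_mul// wnorm_mul//.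
by move=> i k ik; rewrite expr1n mul1r hw.
Qed.

End Seminorms.

(** * The c_0-sum of finite-dimensional blocks *)

Section C0Sum.
Variables (R : realType) (K : nat -> nat) (w : nat -> nat -> R).
Implicit Types x y : nat -> {poly R[i]}.

Definition blk x n : R := bnorm (K n) (w n) (x n).

(** Block [n] is the space of polynomials modulo ['X^(K n)]. Norms tending to
zero, rather than merely bounded ones, are what strong continuity requires. *)
Definition c0mem : {pred nat -> {poly R[i]}} := fun x =>
  `[< (forall n, (size (x n) <= K n)%N) /\ blk x n @[n --> \oo] --> (0 : R) >].

Lemma c0mem_submod : submod_closed c0mem.
Proof.
split.
  apply/asboolP; split=> [n|]; first by rewrite size_poly0.
  rewrite (_ : blk _ = cst 0) ?funeqE => [|n]; first exact: cvg_cst.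
  by rewrite /blk (seminorm0 (seminorm_bnorm _ _)).
move=> z x y /asboolP[sx cx] /asboolP[sy cy]; apply/asboolP; split=> [n|].
  by rewrite (leq_trans (size_polyD _ _))// geq_max sy (leq_trans (size_scale_leq _ _) (sx n)).
apply: (@squeeze_cvgr _ _ _ _ (fun=> 0) (fun n => cabs z * blk x n + blk y n)).
- apply: nearW => n; rewrite bnorm_ge0/=.
  have [bD bZ _] := seminorm_bnorm (K n) (w n).
  by rewrite /blk -bZ; exact: bD.
- exact: cvg_cst.
- have -> : (0 : R) = cabs z * 0 + 0 by rewrite mulr0 addr0.
  by apply: cvgD; [exact: cvgMl_tmp|exact: cy].
Qed.

HB.instance Definition _ := GRing.isSubmodClosed.Build R[i] (nat -> {poly R[i]})
  c0mem c0mem_submod.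

Record c0sum := C0Sum { c0val :> nat -> {poly R[i]}; _ : c0val \in c0mem }.

HB.instance Definition _ := [isSub for c0val].
HB.instance Definition _ := [Choice of c0sum by <:].
HB.instance Definition _ := [SubChoice_isSubLmodule of c0sum by <:].

Implicit Types X Y Z : c0sum.

Lemma c0_size X n : (size (X n) <= K n)%N.
Proof. by case: X => x /= /asboolP[]. Qed.

Lemma c0_cvg X : blk X n @[n --> \oo] --> (0 : R).
Proof. by case: X => x /= /asboolP[]. Qed.

Lemma c0_eqP X Y : (forall n, X n = Y n) -> X = Y.
Proof. by move=> h; apply: val_inj; apply/funext => n; exact: h. Qed.

Lemma c0valB X Y n : (X - Y) n = X n - Y n. Proof. by []. Qed.
Lemma c0valZ z X n : (z *: X) n = z *: X n. Proof. by []. Qed.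

Lemma blk_ge0 x n : 0 <= blk x n.
Proof. exact: bnorm_ge0. Qed.

Definition c0norm X : R := sup (range (blk X)).

Lemma blk_le_c0norm X n : blk X n <= c0norm X.
Proof.
apply: ub_le_sup; last by exists n.
have /cvg_seq_bounded[M [_ h0]] : cvgn (blk X).
  by apply/cvg_ex; exists 0; exact: c0_cvg.
have h := h0 (M + 1); rewrite ltrDl ltr01 in h; have {}h := h isT.
exists (M + 1) => _ [k _ <-].
by rewrite (le_trans (ler_norm _))//; exact: h.
Qed.

Lemma c0norm_le X b : (forall n, blk X n <= b) -> c0norm X <= b.
Proof. by move=> h; apply: ge_sup; [exists (blk X 0), 0%N|move=> _ [n _ <-]]. Qed.

Lemma c0norm_ge0 X : 0 <= c0norm X.
Proof. exact: le_trans (blk_ge0 X 0) (blk_le_c0norm X 0). Qed.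

Lemma c0normD X Y : (c0norm (X + Y))%:C <= (c0norm X)%:C + (c0norm Y)%:C.
Proof.
rewrite -rmorphD/= lecR; apply: c0norm_le => n.
have [bD _ _] := seminorm_bnorm (K n) (w n).
by rewrite (le_trans (bD _ _))// lerD// blk_le_c0norm.
Qed.

Lemma c0normZ z X : (c0norm (z *: X))%:C = `|z| * (c0norm X)%:C.
Proof.
rewrite -cabsE -rmorphM/=; congr (_ %:C).
have blkZ n : blk (z *: X) n = cabs z * blk X n.
  by have [_ bZ _] := seminorm_bnorm (K n) (w n); exact: bZ.
apply/le_anti/andP; split.
  by apply: c0norm_le => n; rewrite blkZ ler_wpM2l ?cabs_ge0 ?blk_le_c0norm.
have [->|z0] := eqVneq z 0; first by rewrite cabs0 mul0r c0norm_ge0.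
have z1 : 0 < cabs z.
  by rewrite lt_neqAle cabs_ge0 andbT eq_sym; apply: contra_neq z0 => /cabs_eq0.
rewrite -ler_pdivlMl//; apply: c0norm_le => n.
by rewrite ler_pdivlMl// -blkZ blk_le_c0norm.
Qed.

Lemma c0norm_eq0 X : (c0norm X)%:C = 0 -> X = 0.
Proof.
move=> /complexI X0; apply: c0_eqP => n; apply: (@bnorm_eq0 _ _ (w n)).
  exact: c0_size.
by apply/le_anti; rewrite blk_ge0 -X0 blk_le_c0norm.
Qed.

HB.instance Definition _ :=
  Lmodule_isNormed.Build R[i] c0sum c0normD c0normZ c0norm_eq0.

Lemma c0_normE X : `|X| = (c0norm X)%:C. Proof. by []. Qed.

Lemma gt0_complexE (e : R[i]) : 0 < e -> e = (complex.Re e)%:C /\ 0 < complex.Re e.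
Proof. by case: e => a b; rewrite ltcE/= => /andP[/eqP-> ->]. Qed.

Lemma c0_cvgP {T} {F : set_system T} {FF : Filter F} (f : T -> c0sum) X :
  (f @ F --> X) <-> (forall e : R, 0 < e -> \forall t \near F, c0norm (f t - X) <= e).
Proof.
split=> [/cvgrPdistC_le h e e0|h].
  have := h e%:C; rewrite ltcR => /(_ e0); apply: filterS => t.
  by rewrite c0_normE lecR.
apply/cvgrPdistC_le => e /gt0_complexE[-> e0]; apply: filterS (h _ e0) => t.
by rewrite c0_normE lecR.
Qed.

(** Dominated convergence: the tail blocks are controlled by the bound, the
finitely many remaining ones by blockwise convergence. *)
Lemma c0_dominated_cvg {T} {F : set_system T} {FF : Filter F} (f : T -> c0sum) X
    (g : nat -> R) :
  (g n @[n --> \oo] --> 0) ->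
  (\forall t \near F, forall n, blk (f t - X) n <= g n) ->
  (forall n, blk (f t - X) n @[t --> F] --> 0) -> f @ F --> X.
Proof.
move=> g0 fg fX; apply/c0_cvgP => e e0.
have /cvgrPdistC_le/(_ e e0)[N _ hN] := g0.
have hF : \forall t \near F, forall n : 'I_N, blk (f t - X) n <= e.
  apply: filter_forall => n; have /cvgrPdistC_le/(_ e e0) := fX n.
  by apply: filterS => t; rewrite subr0 => /(le_trans (ler_norm _)).
near=> t; apply: c0norm_le => n; have [nN|Nn] := ltnP n N.
  have hn : forall n : 'I_N, blk (f t - X) n <= e by near: t.
  exact: hn (Ordinal nN).
have /(_ n) hn : forall n, blk (f t - X) n <= g n by near: t.
by have := hN n Nn; rewrite /= subr0 => /(le_trans (ler_norm _)); exact: le_trans.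
Unshelve. all: by end_near. Qed.

(** Coefficients converge because each is bounded by the norm; the Cauchy
estimates pass to the limit block by block, since only finitely many coefficients
enter the norm of a block. *)
Lemma c0_complete (F : set_system c0sum) : ProperFilter F -> cauchy F -> cvg F.
Proof.
move=> FF /cauchyP cF.
have {}cF (e : R) : 0 < e -> exists X : c0sum, \forall Y \near F, c0norm (X - Y) <= e.
  move=> e0; have [|X FX] := cF e%:C; first by rewrite ltcR.
  exists X; apply: filterS FX => Y; rewrite -ball_normE/= c0_normE ltcR.
  exact: ltW.
have coef_dist X Y n k : (k < K n)%N -> cabs ((X n)`_k - (Y n)`_k) <= c0norm (X - Y).
  move=> kK; rewrite -coefB (le_trans _ (blk_le_c0norm _ n))//.
  exact: (@bnorm_coef _ _ (w n) _ _ kK).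
(* real-valued functionals dominated by the coefficients converge along [F] *)
have coefcvg (h : R[i] -> R) n k : (forall z u, `|h z - h u| <= cabs (z - u)) ->
    (k < K n)%N -> cvg ((fun X : c0sum => h (X n)`_k) @ F).
  move=> hh kK; apply/cauchy_cvgP/cauchy_exP => e e0.
  have [X hX] := cF (e / 2) (divr_gt0 e0 (ltr0n _ 2)).
  exists (h (X n)`_k); rewrite /= near_simpl; apply: filterS hX => Y hY.
  rewrite -ball_normE/= (le_lt_trans (hh _ _))//.
  rewrite (le_lt_trans (coef_dist _ _ _ _ kK))// (le_lt_trans hY)//.
  by rewrite ltr_pdivrMr// ltr_pMr// ltr1n.
have hRe z u : `|complex.Re z - complex.Re u| <= cabs (z - u :> R[i]).
  by case: z u => [a b] [a' b']; exact: (Re_le_cabs ((a +i* b) - (a' +i* b'))).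
have hIm z u : `|complex.Im z - complex.Im u| <= cabs (z - u :> R[i]).
  by case: z u => [a b] [a' b']; exact: (Im_le_cabs ((a +i* b) - (a' +i* b'))).
pose y n := \poly_(k < K n) (lim ((fun X : c0sum => complex.Re (X n)`_k) @ F)
  +i* lim ((fun X : c0sum => complex.Im (X n)`_k) @ F)).
have ycvg n k e : (k < K n)%N -> 0 < e -> \forall X \near F, cabs ((c0val X n)`_k - (y n)`_k) <= e.
  move=> kK e0; have e20 : 0 < e / 2 by rewrite divr_gt0.
  have /cvgrPdistC_le/(_ _ e20) h1 := coefcvg _ n k hRe kK.
  have /cvgrPdistC_le/(_ _ e20) h2 := coefcvg _ n k hIm kK.
  apply: filterS2 h1 h2 => X; rewrite coef_poly kK.
  case: (X n)`_k => a b /= h1 h2; rewrite (le_trans (cabs_ReIm _ _))//.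
  by rewrite [leRHS]splitr lerD.
have near_y X e : (\forall Y \near F, c0norm (X - Y) <= e) ->
    forall n, blk (X \- y) n <= e.
  move=> hX n; apply/ler_addgt0Pr => d d0.
  pose s := 1 + \sum_(k < K n) `|w n k|.
  have s0 : 0 < s by rewrite ltr_wpDr// sumr_ge0.
  have [Z [hZ1 hZ2]] : exists Z, c0norm (X - Z) <= e /\
      forall k : 'I_(K n), cabs ((Z n)`_k - (y n)`_k) <= d / s.
    apply: (@filter_ex _ F); apply: filterI => //.
    by apply: filter_forall => k; apply: ycvg => //; rewrite divr_gt0.
  have [bD _ _] := seminorm_bnorm (K n) (w n).
  rewrite /blk /= -[X n](subrK (Z n)) -addrA (le_trans (bD _ _))// lerD//.
    by rewrite (le_trans _ hZ1)// -c0valB; exact: (blk_le_c0norm (X - Z) n).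
  rewrite (le_trans (bnorm_le_coef _ (x := d / s) _ _))//.
  - by rewrite divr_ge0// ltW.
  - by move=> k kK; rewrite coefB; exact: (hZ2 (Ordinal kK)).
  - by rewrite -/s divfK// gt_eqF.
have y_mem : y \in c0mem.
  apply/asboolP; split=> [n|]; first exact: size_poly.
  apply/cvgrPdistC_le => e e0; have e20 : 0 < e / 2 by rewrite divr_gt0.
  have [X hX] := cF _ e20; have {}hX := near_y _ _ hX.
  have /cvgrPdistC_le/(_ _ e20) := c0_cvg X; apply: filterS => n.
  rewrite !subr0 !ger0_norm ?blk_ge0// => hn.
  have [bD _ _] := seminorm_bnorm (K n) (w n).
  have sN := seminormN (seminorm_bnorm (K n) (w n)).
  rewrite /blk -(subKr (X n) (y n)) (le_trans (bD _ _))// sN.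
  by rewrite [leRHS]splitr lerD//; exact: hX.
apply/cvg_ex; exists (C0Sum y_mem).
apply/(@c0_cvgP _ F _ id) => e e0; have e20 : 0 < e / 2 by rewrite divr_gt0.
have [X hX] := cF _ e20; have hy := near_y _ _ hX.
apply: filterS hX => Z hZ; apply: c0norm_le => n.
have [bD _ _] := seminorm_bnorm (K n) (w n).
have sN := seminormN (seminorm_bnorm (K n) (w n)).
rewrite /blk c0valB -[Z n](subrK (X n)) -addrA (le_trans (bD _ _))//.
rewrite [leRHS]splitr lerD//; last exact: hy.
by rewrite -sN opprB (le_trans _ hZ)//; exact: (blk_le_c0norm (X - Z) n).
Qed.

HB.instance Definition _ := Uniform_isComplete.Build c0sum c0_complete.

(** Symbols of block-diagonal operators. The bound is uniform in the block, so that
the operators preserve the c_0-sum. *)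
Record multiplier := Multiplier {
  sym : nat -> {poly R[i]};
  symB : R;
  sym_le : forall n v, bnorm (K n) (w n) (sym n * v) <= symB * bnorm (K n) (w n) v
}.

Lemma mult_mem (m : multiplier) X :
  (fun n => take_poly (K n) (sym m n * X n)) \in c0mem.
Proof.
apply/asboolP; split=> [n|]; first exact: size_take_poly.
apply: (@squeeze_cvgr _ _ _ _ (fun=> 0) (fun n => symB m * blk X n)).
- apply: nearW => n; rewrite blk_ge0/= /blk.
  by have [_ _ ->] := seminorm_bnorm (K n) (w n); exact: sym_le.
- exact: cvg_cst.
- by rewrite -(mulr0 (symB m)); apply: cvgMl_tmp; exact: c0_cvg.
Qed.

Definition mult m X : c0sum := C0Sum (mult_mem m X).

Lemma mult_linear m : linear (mult m).
Proof.
move=> z X Y; apply: c0_eqP => n /=.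
by rewrite mulrDr -scalerAr take_polyD take_polyZ.
Qed.

HB.instance Definition _ m := GRing.isLinear.Build R[i] c0sum c0sum _ (mult m)
  (mult_linear m).

Lemma multE m X n : mult m X n = take_poly (K n) (sym m n * X n).
Proof. by []. Qed.

Lemma blk_mult m X n : blk (mult m X) n = bnorm (K n) (w n) (sym m n * X n).
Proof. by rewrite /blk multE; have [_ _ ->] := seminorm_bnorm (K n) (w n). Qed.

Lemma c0norm_mult m X b : 0 <= b ->
  (forall n v, bnorm (K n) (w n) (sym m n * v) <= b * bnorm (K n) (w n) v) ->
  c0norm (mult m X) <= b * c0norm X.
Proof.
move=> b0 hb; apply: c0norm_le => n; rewrite blk_mult (le_trans (hb _ _))//.
by rewrite ler_wpM2l// blk_le_c0norm.
Qed.

Lemma opnorm_mult m b : 0 <= b ->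
  (forall n v, bnorm (K n) (w n) (sym m n * v) <= b * bnorm (K n) (w n) v) ->
  (opnorm (mult m) <= b%:E)%E.
Proof.
move=> b0 hb; apply: ge_ereal_sup => _ [X /= X1 <-]; rewrite lee_fin.
rewrite (le_trans (c0norm_mult X b0 hb))// -[leRHS]mulr1 ler_wpM2l//.
Qed.

End C0Sum.

(** * Exponential and trigonometric estimates *)

Section Scalars.
Context {R : realType}.
Implicit Types (x t h r N : R) (j k m : nat).

Lemma geometric_le r m : 0 <= r -> r < 1 -> \sum_(j < m) r ^+ j <= (1 - r)^-1.
Proof.
move=> r0 r1; have r1' : 0 < 1 - r by rewrite subr_gt0.
rewrite -[leRHS]mul1r ler_pdivlMr// mulrC -[1 - r]opprB mulNr -subrX1 opprB.
by rewrite lerBlDr lerDl exprn_ge0.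
Qed.

Lemma expR_series_le t m : 0 <= t -> \sum_(j < m) exp_coeff t j <= expR t.
Proof.
move=> t0; rewrite -(big_mkord xpredT (exp_coeff t)).
apply: nondecreasing_cvgn_le (is_cvg_series_exp_coeff t) m.
by apply: nondecreasing_series => j *; exact: exp_coeff_ge0.
Qed.

Lemma expR_series_cvg t : \sum_(j < m) exp_coeff t j @[m --> \oo] --> expR t.
Proof.
rewrite (_ : (fun m => _) = series (exp_coeff t)).
  exact: is_cvg_series_exp_coeff.
by apply/funext => m; rewrite /series/= big_mkord.
Qed.

Lemma exp_coeffS t j : j.+1%:R * exp_coeff t j.+1 = t * exp_coeff t j.
Proof.
rewrite /exp_coeff/= factS natrM exprS; field.
by rewrite -[1 + _](natrD _ 1 j) !pnatr_eq0 -lt0n fact_gt0.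
Qed.

Lemma exp_coeffD t x k :
  exp_coeff (t + x) k = \sum_(j < k.+1) exp_coeff t j * exp_coeff x (k - j)%N.
Proof.
rewrite [t + x]addrC /exp_coeff/= exprDn mulr_suml; apply: eq_bigr => j _.
have jk : (j <= k)%N by rewrite -ltnS.
rewrite -(bin_fact jk) !natrM -[X in X / _]mulr_natr.
have ? : ('C(k, j))%:R != 0 :> R by rewrite pnatr_eq0 -lt0n bin_gt0.
have ? i : (i`!)%:R != 0 :> R by rewrite pnatr_eq0 -lt0n fact_gt0.
by field; apply/and3P.
Qed.

Lemma expRN_ge t : 1 - t <= expR (- t).
Proof. exact: expR_ge1Dx. Qed.

Lemma expRN_le1 t : 0 <= t -> expR (- t) <= 1.
Proof. by move=> t0; rewrite expR_le1 oppr_le0. Qed.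

Lemma expRN_le t : 0 <= t -> expR (- t) <= 1 - t + t ^+ 2.
Proof.
move=> t0; have h : (expR t)^-1 <= (1 + t)^-1.
  by rewrite lef_pV2 ?posrE ?expR_gt0 ?ltr_pwDl// expR_ge1Dx.
rewrite expRN (le_trans h)// -[leLHS]mul1r ler_pdivrMr ?ltr_pwDl//.
by rewrite -subr_ge0 (_ : _ - 1 = t ^+ 3) ?exprn_ge0//; ring.
Qed.

Definition cis x : R[i] := cos x +i* sin x.

Lemma cis0 : cis 0 = 1.
Proof. by rewrite /cis cos0 sin0. Qed.

Lemma cisD x t : cis (x + t) = cis x * cis t.
Proof.
rewrite /cis cosD sinD; apply/eqP; rewrite eq_complex/= eqxx/=.
by rewrite addrC.
Qed.

Lemma cabs_cis x : cabs (cis x) = 1.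
Proof. by rewrite /cabs normc_def/= cos2Dsin2 sqrtr1. Qed.

Lemma mean_value_le (f df : R -> R) (b x : R) : 0 <= x -> f 0 = 0 ->
  (forall y : R, is_derive y 1 f (df y)) ->
  (forall y, 0 <= y -> y <= x -> `|df y| <= b) -> `|f x| <= b * x.
Proof.
move=> x0 f0 fdf hb; have [|c] := MVT_segment x0 (fun y _ => fdf y).
  apply: continuous_subspaceT => y.
  by apply/differentiable_continuous/derivable1_diffP; case: (fdf y).
rewrite in_itv/= => /andP[c0 cx]; rewrite f0 !subr0 => ->.
by rewrite normrM (ger0_norm x0) ler_wpM2r// hb.
Qed.

Lemma sin_le_id x : 0 <= x -> `|sin x| <= x.
Proof.
move=> x0; rewrite -[leRHS]mul1r; apply: (mean_value_le (df := cos)) => // [|y _ _].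
  exact: sin0.
by rewrite ler_norml cos_geN1 cos_le1.
Qed.

Lemma cosB1_le b x : 0 <= x -> (forall y, 0 <= y -> y <= x -> `|sin y| <= b) ->
  `|cos x - 1| <= b * x.
Proof.
move=> x0 hb; apply: (@mean_value_le (fun y => cos y - 1) (fun y => - sin y)) => //.
- by rewrite cos0 subrr.
- by move=> y; apply: is_derive_eq; rewrite subr0.
- by move=> y y0 yx; rewrite normrN hb.
Qed.

Lemma cisB1_le x : 0 <= x -> cabs (cis x - 1) <= 2 * x.
Proof.
move=> x0; rewrite (_ : cis x - 1 = (cos x - 1) +i* sin x).
  rewrite (le_trans (cabs_ReIm _ _))// mulrDl mul1r lerD ?sin_le_id//.
  rewrite -[leRHS]mul1r cosB1_le// => y _ _.
  by rewrite ler_norml sin_geN1 sin_le1.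
by rewrite /cis; apply/eqP; rewrite eq_complex/= subr0 !eqxx.
Qed.

Lemma cisB1B_le x : 0 <= x -> cabs (cis x - 1 - (0 +i* x)) <= 2 * x ^+ 2.
Proof.
move=> x0; have cos_le y : 0 <= y -> y <= x -> `|cos y - 1| <= x ^+ 2.
  move=> y0 yx; rewrite (le_trans (@cosB1_le x _ y0 _))// => [z z0 zy|].
    by rewrite (le_trans (sin_le_id z0))// (le_trans zy).
  by rewrite expr2 ler_wpM2l.
rewrite (_ : _ - _ = (cos x - 1) +i* (sin x - x)).
  rewrite (le_trans (cabs_ReIm _ _))// mulrDl mul1r lerD ?cos_le//.
  rewrite expr2; apply: (@mean_value_le (fun y => sin y - y) (fun y => cos y - 1)) => //.
  - by rewrite sin0 subr0.
  - move=> y y0 yx; rewrite (le_trans (@cosB1_le 1 _ y0 _))// ?mul1r// => z _ _.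
    by rewrite ler_norml sin_geN1 sin_le1.
by rewrite /cis; apply/eqP; rewrite eq_complex/= !subr0 !eqxx.
Qed.

End Scalars.

(** * Symbols of the semigroup, of its generator and of its resolvent *)

Section Symbols.
Context {R : realType}.
Variable K : nat.
Implicit Types (t h r N : R) (v : {poly R[i]}) (z : R[i]).

(** In one block the generator is [iN + (shift - 1)]: a nilpotent shift, damped to
a generator of Poisson type and moved to the frequency [N]. Hence [sg_sym] is
[e^(iNt)] times the generating polynomial of the Poisson distribution of mean [t],
cut at degree [K], and [res_sym z] is the truncated Neumann series of [(z - 'X)^-1]. *)
Definition sg_coef N t j : R[i] := cis (N * t) * (expR (- t) * exp_coeff t j)%:C.

Definition sg_sym N t : {poly R[i]} := \poly_(j < K) sg_coef N t j.

Definition gen_sym N : {poly R[i]} := 'X + (-1 +i* N)%:P.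

Definition res_sym z : {poly R[i]} := \poly_(j < K) z ^- j.+1.

Lemma cabs_sg_coef N t j : 0 <= t -> cabs (sg_coef N t j) = expR (- t) * exp_coeff t j.
Proof.
move=> t0; rewrite cabsM cabs_cis mul1r cabs_real ger0_norm//.
by rewrite mulr_ge0 ?expR_ge0 ?exp_coeff_ge0.
Qed.

(** The value [e^(-t) e^(tr)] of the Poisson generating function at [r]. *)
Lemma l1norm_sg_sym N t r : 0 <= t -> 0 <= r ->
  l1norm K r (sg_sym N t) <= expR (- (t * (1 - r))).
Proof.
move=> t0 r0; rewrite mulrBr mulr1 opprB addrC expRD.
rewrite (@le_trans _ _ (expR (- t) * \sum_(j < K) exp_coeff (t * r) j))//.
  rewrite mulr_sumr; apply: ler_sum => j _.
  rewrite coef_poly ltn_ord cabs_sg_coef// -mulrA ler_wpM2l ?expR_ge0//.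
  by rewrite /exp_coeff/= exprMn mulrAC.
by rewrite ler_wpM2l ?expR_ge0// expR_series_le// mulr_ge0.
Qed.

Lemma sg_sym0 N : take_poly K (sg_sym N 0) = take_poly K 1.
Proof.
apply/polyP => k; rewrite !coef_take_poly coef1 coef_poly; case: ltnP => // kK.
rewrite /sg_coef mulr0 cis0 oppr0 expR0 !mul1r /exp_coeff/= expr0n.
by case: k kK => [|k] _; rewrite ?fact0 ?divr1 ?mul0r.
Qed.

Lemma sg_symD N t h : take_poly K (sg_sym N t * sg_sym N h) = take_poly K (sg_sym N (t + h)).
Proof.
apply/polyP => k; rewrite !coef_take_poly; case: ltnP => // kK.
rewrite coefM coef_poly kK /sg_coef exp_coeffD mulrDr cisD opprD expRD mulr_sumr.
rewrite rmorph_sum mulr_sumr; apply: eq_bigr => j _.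
have jK : (j < K)%N by rewrite (leq_ltn_trans _ kK)// -ltnS.
have kjK : (k - j < K)%N by rewrite (leq_ltn_trans _ kK)// leq_subr.
rewrite !coef_poly jK kjK /sg_coef !rmorphM/=; ring.
Qed.

Lemma res_symK z : z != 0 -> take_poly K ((z%:P - 'X) * res_sym z) = take_poly K 1.
Proof.
move=> z0; apply/polyP => k; rewrite !coef_take_poly; case: ltnP => // kK.
rewrite mulrBl coefB coefCM coefXM coef1 coef_poly kK.
case: k kK => [|k] kK /=; first by rewrite expr1 subr0 divff.
rewrite coef_poly (ltn_trans _ kK)//.
by rewrite [z ^+ k.+2]exprS invfM mulrA divff// mul1r subrr.
Qed.

Lemma maxnorm_res_sym z : 1 <= cabs z -> maxnorm K (res_sym z) <= 1.
Proof.
move=> z1; apply: maxnorm_le => // k kK; rewrite coef_poly kK cabsV cabsX.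
by rewrite invf_le1 ?exprn_ege1// exprn_gt0// (lt_le_trans ltr01).
Qed.

Lemma l1norm_res_sym z r : 1 <= cabs z -> 0 <= r -> r < 1 ->
  l1norm K r (res_sym z) <= (1 - r)^-1.
Proof.
move=> z1 r0 r1; rewrite (le_trans _ (geometric_le K r0 r1))//.
apply: ler_sum => j _; rewrite coef_poly ltn_ord cabsV cabsX.
rewrite -[leRHS]mul1r ler_wpM2r ?exprn_ge0//.
by rewrite invf_le1 ?exprn_ege1// exprn_gt0// (lt_le_trans ltr01).
Qed.

Lemma l1norm_res_sym_le1 z : 2 <= cabs z -> l1norm K 1 (res_sym z) <= 1.
Proof.
move=> z2; have z0 : 0 < cabs z by rewrite (lt_le_trans _ z2).
have h0 : 0 <= 2^-1 :> R by rewrite invr_ge0.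
have h1 : 2^-1 < 1 :> R by rewrite invf_lt1// ltr1n.
rewrite (@le_trans _ _ (2^-1 * \sum_(j < K) 2^-1 ^+ j))//; last first.
  rewrite (le_trans (ler_wpM2l h0 (geometric_le K h0 h1)))//.
  by rewrite [X in _ / (X - _)]splitr div1r addrK mulfV.
rewrite mulr_sumr; apply: ler_sum => j _.
rewrite coef_poly ltn_ord cabsV cabsX expr1n mulr1 -exprS -exprVn.
apply: lerXn2r; rewrite ?nnegrE ?invr_ge0 ?(ltW z0)//.
by rewrite lef_pV2 ?posrE.
Qed.

Lemma cabs_gen_sym0 N : 0 <= N -> cabs (-1 +i* N) <= 1 + N.
Proof. by move=> N0; rewrite (le_trans (cabs_ReIm _ _))// normrN1 ger0_norm. Qed.

Lemma l1norm_gen_sym N : 0 <= N -> l1norm K 1 (gen_sym N) <= N + 2.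
Proof.
move=> N0; pose F j := cabs ((gen_sym N)`_j).
rewrite /l1norm (eq_bigr (fun j : 'I_K => F j)); last first.
  by move=> j _; rewrite expr1n mulr1.
have F0 j : 0 <= F j by exact: cabs_ge0.
rewrite (@le_trans _ _ (\sum_(j < K.+2) F j))//.
  rewrite (big_ord_widen K.+2 F) ?leqW// big_mkcond/=.
  by apply: ler_sum => j _; case: ifP.
rewrite !big_ord_recl big1 /F/gen_sym => [|j _]; rewrite !coefD !coefX !coefC/=.
  rewrite !addr0 add0r cabs1 (le_trans (lerD (cabs_gen_sym0 N0) (lexx _)))//.
  by rewrite -subr_ge0 (_ : _ - _ = 0)//; ring.
by rewrite addr0 cabs0.
Qed.

(** The coefficients of index at least 2 add up to at most the probability that a Poisson
variable of mean [t] is at least 2, which is at most [t ^+ 2]. *)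
Lemma l1norm_split2 (F : nat -> R[i]) (t b0 b1 : R) : 0 <= t ->
  cabs (F 0%N) <= b0 -> cabs (F 1%N) <= b1 ->
  (forall j, cabs (F j.+2) = expR (- t) * exp_coeff t j.+2) ->
  l1norm K 1 (\poly_(j < K) F j) <= b0 + b1 + t ^+ 2.
Proof.
move=> t0 h0 h1 h2.
rewrite (@le_trans _ _ (\sum_(j < K.+2) cabs (F j)))//.
  rewrite /l1norm (big_ord_widen K.+2 (fun j => cabs (\poly_(j < K) F j)`_j * 1 ^+ j)).
    rewrite big_mkcond/=; apply: ler_sum => j _; case: ifP => [jK|_].
      by rewrite coef_poly jK expr1n mulr1.
    exact: cabs_ge0.
  by rewrite leqW.
rewrite !big_ord_recl -addrA lerD// lerD//.
rewrite (eq_bigr (fun j : 'I_K => expR (- t) * exp_coeff t j.+2)); last first.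
  by move=> j _; exact: h2.
have := expR_series_le K.+2 t0; rewrite !big_ord_recl/= /exp_coeff/= !fact0 !expr0 expr1 !divr1.
rewrite -mulr_sumr addrA -lerBrDl => hs.
rewrite (le_trans (ler_wpM2l (expR_ge0 _) hs))// mulrBr -expRD addNr expR0.
have := ler_wpM2r (_ : 0 <= 1 + t) (expRN_ge t); rewrite addr_ge0// => /(_ isT) h.
rewrite lerBlDr -lerBlDl (le_trans _ h)// -subr_ge0.
by rewrite (_ : _ - _ = 0)//; ring.
Qed.

Lemma sg_symB1_poly N h : take_poly K (sg_sym N h - 1) =
  \poly_(j < K) (sg_coef N h j - (j == 0%N)%:R).
Proof. by apply/polyP => k; rewrite coef_take_poly coefB !coef_poly coef1; case: ltnP. Qed.

Lemma l1norm_take r (c : {poly R[i]}) : l1norm K r (take_poly K c) = l1norm K r c.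
Proof. by apply: eq_bigr => j _; rewrite coef_take_poly ltn_ord. Qed.

Lemma sg_coef0_le N h : 0 <= N -> 0 <= h -> cabs (sg_coef N h 0 - 1) <= 2 * (N * h) + h.
Proof.
move=> N0 h0; rewrite /sg_coef /exp_coeff/= fact0 expr0 divr1 mulr1.
rewrite (_ : _ - 1 = (cis (N * h) - 1) + cis (N * h) * (expR (- h) - 1)%:C).
  rewrite (le_trans (cabsD _ _))// lerD ?cisB1_le ?mulr_ge0//.
  rewrite cabsM cabs_cis mul1r cabs_real distrC ger0_norm ?subr_ge0 ?expRN_le1//.
  by rewrite lerBlDr -lerBlDl expRN_ge.
by rewrite rmorphB/=; ring.
Qed.

(** First and second order Taylor estimates at [h = 0]; the second one identifies
the generator in a fixed block, with a constant depending on the block. *)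
Lemma l1norm_sg_symB1 N h : 0 <= N -> 0 <= h -> h <= 1 ->
  l1norm K 1 (sg_sym N h - 1) <= (2 * N + 3) * h.
Proof.
move=> N0 h0 h1; rewrite -l1norm_take sg_symB1_poly.
rewrite (le_trans (l1norm_split2 (b0 := 2 * (N * h) + h) (b1 := h) h0 _ _ _))//.
- exact: sg_coef0_le.
- rewrite subr0 cabs_sg_coef// /exp_coeff/= expr1 divr1//.
  by rewrite -[leRHS]mul1r ler_wpM2r// expRN_le1.
- by move=> j; rewrite subr0 cabs_sg_coef.
rewrite -subr_ge0 (_ : _ - _ = h * (1 - h)) ?mulr_ge0 ?subr_ge0//; ring.
Qed.

Lemma l1norm_sg_symB1B N h : 0 <= N -> 0 <= h ->
  l1norm K 1 (sg_sym N h - 1 - h%:C *: gen_sym N) <= (2 * N ^+ 2 + 4 * N + 3) * h ^+ 2.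
Proof.
move=> N0 h0; pose F j := sg_coef N h j - (j == 0%N)%:R
  - h%:C * ((j == 1%N)%:R + (j == 0%N)%:R * (-1 +i* N)).
have Nh : 0 <= N * h by rewrite mulr_ge0.
rewrite -l1norm_take (_ : take_poly K _ = \poly_(j < K) F j); last first.
  apply/polyP => k; rewrite coef_take_poly !coefB !coef_poly coef1 coefZ coefD.
  rewrite coefX coefC /F; case: ltnP => // _.
  by case: k => [|k]/=; rewrite ?mul1r ?mul0r.
rewrite (le_trans (l1norm_split2
  (b0 := 2 * (N * h) ^+ 2 + h ^+ 2 + 2 * (N * h) * h) (b1 := (2 * (N * h) + h) * h) h0 _ _ _))//.
- rewrite /F/= add0r mul1r /sg_coef /exp_coeff/= fact0 expr0 divr1 mulr1.
  rewrite (_ : _ - _ = (cis (N * h) - 1 - (0 +i* (N * h)))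
      + cis (N * h) * (expR (- h) - 1 + h)%:C - (cis (N * h) - 1) * h%:C).
    rewrite (le_trans (cabsD _ _))// cabsN !cabsM cabs_real (ger0_norm h0).
    rewrite lerD ?ler_wpM2r ?cisB1_le// (le_trans (cabsD _ _))// lerD ?cisB1B_le//.
    rewrite cabsM cabs_cis mul1r cabs_real ger0_norm.
      by have := expRN_le h0; lra.
    by have := expRN_ge h; lra.
  rewrite (_ : (-1 +i* N) = -1 + (0 +i* N)); last first.
    by apply/eqP; rewrite eq_complex/= oppr0 !addr0 add0r !eqxx.
  rewrite (_ : 0 +i* (N * h) = h%:C * (0 +i* N)); last first.
    by apply/eqP; rewrite eq_complex/= !(mul0r, mulr0, subr0, addr0) mulrC !eqxx.
  rewrite !(rmorphB, rmorphD)/= rmorph1; ring.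
- rewrite /F/= subr0 mul0r addr0 mulr1 /sg_coef /exp_coeff/= expr1 divr1.
  rewrite (_ : _ - _ = (sg_coef N h 0 - 1) * h%:C).
    by rewrite cabsM cabs_real (ger0_norm h0) ler_wpM2r// sg_coef0_le.
  by rewrite /sg_coef /exp_coeff/= expr0 fact0 divr1 mulr1 !rmorphM/=; ring.
- by move=> j; rewrite /F/= mul0r addr0 mulr0 !subr0 cabs_sg_coef.
by rewrite -subr_ge0 (_ : _ - _ = 0)//; ring.
Qed.

End Symbols.

(** * The geometric weights *)

Section Weights.
Context {R : realType}.
Variables (M : R) (K : nat).
Hypothesis M0 : 0 < M.
Implicit Types (t : R) (v : {poly R[i]}) (z : R[i]).

(** The ratio [1 + M^-1] gives a decay rate [(M + 1)^-1] in time. With the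
factor [M^-1] the maximum norm is at most [M] times the weighted norm, which is the
constant that the resolvent bound allows. *)
Definition wt (k : nat) : R := (1 + M^-1) ^+ (K - k) / M.

Let rho0 : 0 < 1 + M^-1.
Proof. by rewrite addr_gt0// invr_gt0. Qed.

Lemma wt_ge0 k : 0 <= wt k.
Proof. by rewrite divr_ge0 ?exprn_ge0// ltW. Qed.

Lemma wt_shift i k : (i + k < K)%N ->
  `|wt (k + i)| <= (1 + M^-1)^-1 ^+ k * `|wt i|.
Proof.
move=> ik; rewrite !ger0_norm ?wt_ge0// /wt mulrA ler_wpM2r ?invr_ge0 ?(ltW M0)//.
rewrite (_ : (K - i = k + (K - (k + i)))%N).
  by rewrite exprD mulrA -exprMn mulVf ?gt_eqF// expr1n mul1r.
by lia.
Qed.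

Lemma rhoV_lt1 : (1 + M^-1)^-1 < 1.
Proof. by rewrite invf_lt1// ltrDl invr_gt0. Qed.

Lemma onem_rhoV : 1 - (1 + M^-1)^-1 = (M + 1)^-1.
Proof.
have M1 : M + 1 != 0 by rewrite gt_eqF// addr_gt0.
by field; rewrite M1 gt_eqF.
Qed.

Lemma wt_noninc i k : (i + k < K)%N -> `|wt (k + i)| <= `|wt i|.
Proof.
move=> ik; rewrite (le_trans (wt_shift ik))// -[leRHS]mul1r ler_wpM2r//.
by rewrite exprn_ile1 ?invr_ge0 ?ltW// ?rhoV_lt1.
Qed.

Lemma sum_cabs_le v : \sum_(k < K) cabs v`_k <= M * wnorm K wt v.
Proof.
rewrite mulr_sumr; apply: ler_sum => k _; rewrite mulrA ger0_norm ?wt_ge0//.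
rewrite -[leLHS]mul1r ler_wpM2r ?cabs_ge0// /wt mulrCA divff ?gt_eqF// mulr1.
by rewrite exprn_ege1// lerDl invr_ge0 ltW.
Qed.

Lemma maxnorm_le_sum v : maxnorm K v <= \sum_(k < K) cabs v`_k.
Proof.
apply: maxnorm_le => [|k kK]; first by apply: sumr_ge0 => k _; exact: cabs_ge0.
by rewrite (bigD1 (Ordinal kK))//= lerDl sumr_ge0// => i _; exact: cabs_ge0.
Qed.

Lemma bnorm_sg_sym N t v : 0 <= t -> bnorm K wt (sg_sym K N t * v) <= bnorm K wt v.
Proof.
move=> t0; rewrite (le_trans (bnorm_mul _ _ wt_noninc))//.
rewrite -[leRHS]mul1r ler_wpM2r ?bnorm_ge0// (le_trans (l1norm_sg_sym _ _ t0 ler01))//.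
by rewrite subrr mulr0 oppr0 expR0.
Qed.

(** The weighted norm decays exponentially and is at least [M^-1] times the
maximum norm, so the block norm decays after a delay of order [M ln M]. *)
Lemma bnorm_sg_sym_decay N t v : 0 <= t ->
  bnorm K wt (sg_sym K N t * v) <= (M + 1) * expR (- (t / (M + 1))) * bnorm K wt v.
Proof.
move=> t0; have r0 : 0 <= (1 + M^-1)^-1 by rewrite invr_ge0 ltW.
have hw : wnorm K wt (sg_sym K N t * v) <= expR (- (t / (M + 1))) * wnorm K wt v.
  rewrite (le_trans (wnorm_mul _ _ r0 wt_shift))// ler_wpM2r ?wnorm_ge0//.
  by rewrite -onem_rhoV l1norm_sg_sym.
rewrite /bnorm (@le_trans _ _ ((M + 1) * wnorm K wt (sg_sym K N t * v)))//.
  by rewrite mulrDl mul1r lerD2r (le_trans (maxnorm_le_sum _)) ?sum_cabs_le.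
rewrite -mulrA ler_wpM2l ?addr_ge0 ?(ltW M0)// (le_trans hw)// ler_wpM2l ?expR_ge0//.
exact: wnorm_le_bnorm.
Qed.

(** This is the only place where resonance, that is [z] close to 1, costs a factor
[M]. The Neumann series has bounded coefficients, so the maximum norm of the image
is at most [M] times the weighted norm: the logarithm lost in time does not appear
here. *)
Lemma bnorm_res_sym z v : 1 <= cabs z ->
  bnorm K wt (res_sym K z * v) <= (2 * M + 1) * bnorm K wt v.
Proof.
move=> z1; have r0 : 0 <= (1 + M^-1)^-1 by rewrite invr_ge0 ltW.
rewrite (@le_trans _ _ ((2 * M + 1) * wnorm K wt v))//; last first.
  by rewrite ler_wpM2l ?wnorm_le_bnorm// addr_ge0// mulr_ge0// ltW.
rewrite (_ : 2 * M + 1 = M + (M + 1)); last by ring.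
rewrite [leRHS]mulrDl lerD//.
  rewrite (le_trans (maxnorm_mul_max _ _ _))// (le_trans _ (sum_cabs_le v))//.
  rewrite -[leRHS]mul1r ler_wpM2r ?maxnorm_res_sym//.
  by apply: sumr_ge0 => k _; exact: cabs_ge0.
rewrite (le_trans (wnorm_mul _ _ r0 wt_shift))// ler_wpM2r ?wnorm_ge0//.
by rewrite (le_trans (l1norm_res_sym _ z1 r0 rhoV_lt1))// onem_rhoV invrK.
Qed.

Lemma bnorm_res_sym_le1 z v : 2 <= cabs z -> bnorm K wt (res_sym K z * v) <= bnorm K wt v.
Proof.
move=> z2; rewrite (le_trans (bnorm_mul _ _ wt_noninc))//.
by rewrite -[leRHS]mul1r ler_wpM2r ?bnorm_ge0// l1norm_res_sym_le1.
Qed.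

End Weights.

(** * The semigroup and its resolvent on the imaginary axis *)

Section Semigroup.
Context {R : realType}.
Variables (K : nat -> nat) (M N : nat -> R) (alpha : R).
Hypothesis M0 : forall n, 0 < M n.
Hypothesis N0 : forall n, 0 <= N n.
Hypothesis alpha_ge0 : 0 <= alpha.
Hypothesis MN : forall n, M n <= N n `^ alpha.

Local Notation w := (fun n => wt (M n) (K n)).
Local Notation X := (c0sum K w).
Local Notation cblk := (blk K w).
Local Notation bn n := (bnorm (K n) (wt (M n) (K n))).
Implicit Types (x y : X) (t h s : R).

(* The absolute value makes this a family of contractions indexed by all of [R]. *)
Lemma sg_mult_subproof t n v :
  bn n (sg_sym (K n) (N n) `|t| * v) <= 1 * bn n v.
Proof. by rewrite mul1r; apply: bnorm_sg_sym => //; exact: normr_ge0. Qed.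

Definition sg_mult t : multiplier K w := Multiplier (@sg_mult_subproof t).

Definition poisson_sg t : {linear X -> X} := mult (sg_mult t).

Lemma poisson_sg_coord t x n : 0 <= t -> poisson_sg t x n = take_poly (K n) (sg_sym (K n) (N n) t * x n).
Proof. by move=> t0; rewrite -{2}(ger0_norm t0). Qed.

Lemma opnorm_poisson_sg t : (opnorm (poisson_sg t) <= 1%:E)%E.
Proof. by apply: opnorm_mult => // n v; exact: sg_mult_subproof. Qed.

Lemma take_c0 x n : take_poly (K n) (x n) = x n.
Proof. by rewrite take_poly_id// c0_size. Qed.

Lemma blk_poisson_sgB1 h x n : 0 <= h ->
  cblk (poisson_sg h x - x : X) n = bn n ((sg_sym (K n) (N n) h - 1) * x n).
Proof.
move=> h0; have [_ _ bT] := seminorm_bnorm (K n) (wt (M n) (K n)).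
rewrite /blk c0valB poisson_sg_coord// -{2}take_c0 -raddfB/= bT.
by rewrite mulrBl mul1r.
Qed.

Lemma blk_poisson_sgB1_le h x n : 0 <= h -> h <= 1 ->
  cblk (poisson_sg h x - x : X) n <= (2 * N n + 3) * h * cblk x n.
Proof.
move=> h0 h1; rewrite blk_poisson_sgB1// (le_trans (bnorm_mul _ _ (wt_noninc (M0 n))))//.
by rewrite ler_wpM2r ?bnorm_ge0// l1norm_sg_symB1.
Qed.

Lemma near_small : \forall h \near (0 : R)^'+, (0 : R) < h <= 1.
Proof.
near=> h; apply/andP; split; first by [].
by near: h; exact: nbhs_right_le.
Unshelve. all: by end_near. Qed.

Lemma cvg_right0M (c : R) : c * h @[h --> 0^'+] --> 0.
Proof.
rewrite -[X in _ --> X](mulr0 c); apply: cvgMl_tmp.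
exact: (@cvg_at_right_filter _ _ id 0).
Qed.

(** Contractivity gives the domination, the Taylor estimate the convergence in each
block. *)
Lemma poisson_sg_C0 : C0_semigroup poisson_sg.
Proof.
split.
- by move=> t _; rewrite (le_lt_trans (opnorm_poisson_sg t))// ltry.
- move=> x; apply: c0_eqP => n.
  by rewrite poisson_sg_coord// -take_poly_mull sg_sym0 take_poly_mull mul1r take_c0.
- move=> s t x s0 t0; apply: c0_eqP => n; rewrite !poisson_sg_coord ?addr_ge0//.
  by rewrite take_poly_mulr mulrA -[RHS]take_poly_mull sg_symD take_poly_mull.
- move=> x; apply: (@c0_dominated_cvg _ _ _ _ _ _ _ _ (fun n => 2 * cblk x n)).
  + by rewrite -(mulr0 2); apply: cvgMl_tmp; exact: c0_cvg.
  + near=> h => n; have /andP[h0 _] : 0 < h <= 1 by near: h; exact: near_small.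
    have [bD _ bT] := seminorm_bnorm (K n) (wt (M n) (K n)).
    rewrite /blk c0valB (le_trans (bD _ _))// mulrDl mul1r lerD//.
      by rewrite poisson_sg_coord ?(ltW h0)// bT; apply: bnorm_sg_sym => //; exact: ltW.
    by rewrite (seminormN (seminorm_bnorm _ _)).
  + move=> n; apply: (@squeeze_cvgr _ _ _ _ (fun=> 0)
      (fun h => (2 * N n + 3) * cblk x n * h)).
    * near=> h; have /andP[h0 h1] : 0 < h <= 1 by near: h; exact: near_small.
      by rewrite blk_ge0/= mulrAC blk_poisson_sgB1_le// ltW.
    * exact: cvg_cst.
    * exact: cvg_right0M.
Unshelve. all: by end_near. Qed.

Local Notation A := (generator poisson_sg).

Definition quotient x h : X := (h^-1)%:C *: (poisson_sg h x - x).

Lemma quotient_coord x n h : 0 < h ->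
  bn n (quotient x h n - gen_sym (N n) * x n) <=
  (2 * N n ^+ 2 + 4 * N n + 3) * cblk x n * h.
Proof.
move=> h0; have [_ bZ bT] := seminorm_bnorm (K n) (wt (M n) (K n)).
have hC : (h^-1)%:C * h%:C = 1 :> R[i] by rewrite -rmorphM/= mulVf ?gt_eqF.
rewrite -bT (_ : take_poly _ _ = take_poly (K n)
  ((h^-1)%:C *: ((sg_sym (K n) (N n) h - 1 - h%:C *: gen_sym (N n)) * x n))); last first.
  rewrite take_polyB /quotient c0valZ c0valB poisson_sg_coord ?(ltW h0)//.
  rewrite !mulrBl mul1r -scalerAl !take_polyZ !take_polyB take_polyZ.
  rewrite (take_poly_id (size_take_poly _ _)) [in RHS]scalerBr scalerA hC scale1r.
  by [].
rewrite bT bZ cabs_real ger0_norm ?invr_ge0 ?(ltW h0)// ler_pdivrMl//.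
rewrite (le_trans (bnorm_mul _ _ (wt_noninc (M0 n))))//.
rewrite (le_trans (ler_wpM2r (bnorm_ge0 _ _ _) (l1norm_sg_symB1B _ (N0 n) (ltW h0))))//.
by rewrite /blk -subr_ge0 (_ : _ - _ = 0)//; ring.
Qed.

(** The difference of the generator and [iN] is bounded by 2, so [N] times a vector
is controlled by its image under the generator. *)
Lemma N_bnorm_le n v : N n * bn n v <= bn n (gen_sym (N n) * v) + 2 * bn n v.
Proof.
have [bD bZ _] := seminorm_bnorm (K n) (wt (M n) (K n)).
have -> : N n * bn n v = bn n ((0 +i* N n) *: v).
  by rewrite bZ /cabs normc_def/= expr0n add0r sqrtr_sqr ger0_norm.
rewrite (_ : _ *: v = gen_sym (N n) * v + - (gen_sym 0 * v)); last first.
  rewrite -mulrBl -mul_polyC; congr (_ * _); rewrite /gen_sym opprD addrACA subrr add0r.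
  by rewrite -polyCB; congr (_%:P); apply/eqP; rewrite eq_complex/= subrr subr0 !eqxx.
rewrite (le_trans (bD _ _))// lerD2l (seminormN (seminorm_bnorm _ _)).
rewrite (le_trans (bnorm_mul _ _ (wt_noninc (M0 n))))//.
by rewrite ler_wpM2r ?bnorm_ge0// -[leRHS]add0r l1norm_gen_sym.
Qed.

(** The generator is the maximal blockwise operator. The difference quotients of [x]
are dominated by [2 * N n + 3] times the norms of the blocks of [x], which tend to
zero as soon as the blocks [y n] do, by [N_bnorm_le]. *)
Lemma generatorP x y : dom A x /\ A x = y <->
  forall n, y n = take_poly (K n) (gen_sym (N n) * x n).
Proof.
have quotient_cvg (y' : X) : (forall n, y' n = take_poly (K n) (gen_sym (N n) * x n)) ->
    quotient x h @[h --> 0^'+] --> y'.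
  move=> hy; have blk_y' n : cblk y' n = bn n (gen_sym (N n) * x n).
    by rewrite /blk hy; have [_ _ ->] := seminorm_bnorm (K n) (wt (M n) (K n)).
  have blk_q h n : cblk (quotient x h - y' : X) n = bn n (quotient x h n - gen_sym (N n) * x n).
    have [_ _ bT] := seminorm_bnorm (K n) (wt (M n) (K n)).
    by rewrite /blk c0valB hy -[in RHS]bT take_polyB take_c0.
  apply: (@c0_dominated_cvg _ _ _ _ _ _ _ _
    (fun n => 3 * cblk y' n + 7 * cblk x n)).
  - have -> : (0 : R) = 3 * 0 + 7 * 0 by rewrite !mulr0 addr0.
    by apply: cvgD; apply: cvgMl_tmp; exact: c0_cvg.
  - near=> h => n; have /andP[h0 h1] : 0 < h <= 1 by near: h; exact: near_small.
    have [bD bZ _] := seminorm_bnorm (K n) (wt (M n) (K n)).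
    rewrite {1}/blk c0valB (le_trans (bD _ _))// (seminormN (seminorm_bnorm _ _)).
    have hq : cblk (quotient x h) n <= (2 * N n + 3) * cblk x n.
      rewrite /blk /quotient c0valZ bZ cabs_real ger0_norm ?invr_ge0 ?(ltW h0)//.
      rewrite ler_pdivrMl// mulrCA mulrA; apply: blk_poisson_sgB1_le => //; exact: ltW.
    have := N_bnorm_le n (x n); rewrite -blk_y' -/(cblk x n) => hN.
    by rewrite /blk in hq hN *; lra.
  - move=> n; apply: (@squeeze_cvgr _ _ _ _ (fun=> 0)
      (fun h => (2 * N n ^+ 2 + 4 * N n + 3) * cblk x n * h)).
    * near=> h; have /andP[h0 h1] : 0 < h <= 1 by near: h; exact: near_small.
      by rewrite blk_ge0/= blk_q quotient_coord.
    * exact: cvg_cst.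
    * exact: cvg_right0M.
split=> [[dx <-]|/quotient_cvg qy]; last first.
  by split; [apply/cvg_ex; exists y|apply/cvg_lim => //; exact: norm_hausdorff].
move=> n; apply/eqP; rewrite -subr_eq0; apply/eqP.
apply: (@bnorm_eq0 _ (K n) (wt (M n) (K n))).
  by rewrite -[A x n]take_c0 -take_polyB size_take_poly.
have [bD _ bT] := seminorm_bnorm (K n) (wt (M n) (K n)).
apply/le_anti; rewrite bnorm_ge0 andbT; apply/ler_addgt0Pr => e e0; rewrite add0r.
have e20 : 0 < e / 2 by rewrite divr_gt0.
have /c0_cvgP/(_ _ e20) h1 : quotient x h @[h --> 0^'+] --> A x by exact: dx.
have /cvgrPdistC_le/(_ _ e20) h2 :=
  cvg_right0M ((2 * N n ^+ 2 + 4 * N n + 3) * cblk x n).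
have [h [/andP[h0 _] [hA hC]]] := @filter_ex _ _ _ _
  (filterI near_small (filterI h1 h2)).
rewrite -[A x n]take_c0 -take_polyB bT -(subrK (quotient x h n) (A x n)) -addrA.
rewrite (le_trans (bD _ _))// [leRHS]splitr lerD//.
  rewrite -(seminormN (seminorm_bnorm _ _)) opprB (le_trans _ hA)//.
  exact: (blk_le_c0norm (quotient x h - A x) n).
by rewrite (le_trans (quotient_coord _ _ h0))// (le_trans (ler_norm _))// -[X in `|X|]subr0.
Unshelve. all: by end_near. Qed.

Definition res_bound s : R := 2 * (`|s| + 2) `^ alpha + 1.

Lemma res_bound_ge1 s : 1 <= res_bound s.
Proof. by rewrite lerDr mulr_ge0// powR_ge0. Qed.

Definition omega s n : R[i] := 1 +i* (s - N n).

Lemma cabs_omega_ge1 s n : 1 <= cabs (omega s n).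
Proof. by have := Re_le_cabs (omega s n); rewrite /= normr1. Qed.

Lemma omega_neq0 s n : omega s n != 0.
Proof. by rewrite eq_complex/= oner_eq0. Qed.

(** Far from the frequency [N n] the Neumann series is summable with sum at most
one; close to it [N n <= |s| + 2], and so [M n] is controlled by a power of [s]. *)
Lemma res_mult_subproof s n v :
  bn n (res_sym (K n) (omega s n) * v) <= res_bound s * bn n v.
Proof.
have [w2|w2] := leP 2 (cabs (omega s n)).
  rewrite (le_trans (bnorm_res_sym_le1 (K n) (M0 n) _ w2))// -[leLHS]mul1r.
  by rewrite ler_wpM2r ?bnorm_ge0 ?res_bound_ge1.
rewrite (le_trans (bnorm_res_sym (K n) (M0 n) _ (cabs_omega_ge1 s n)))//.
rewrite ler_wpM2r ?bnorm_ge0// lerD2r ler_wpM2l// (le_trans (MN n))//.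
rewrite ge0_ler_powR ?nnegrE ?addr_ge0//.
have /ltW := le_lt_trans (Im_le_cabs (omega s n)) w2.
rewrite /= distrC => h; rewrite -[N n](subrK s) addrC.
by rewrite lerD ?ler_norm// (le_trans (ler_norm _)).
Qed.

Definition res_mult s : multiplier K w := Multiplier (@res_mult_subproof s).

Lemma opnorm_res_mult s : (opnorm (mult (res_mult s) : X -> X) <= (res_bound s)%:E)%E.
Proof.
apply: opnorm_mult => [|n v]; first exact: le_trans (res_bound_ge1 s).
exact: res_mult_subproof.
Qed.

Lemma omegaE s n : (omega s n)%:P - 'X = (0 +i* s)%:P - gen_sym (N n) :> {poly R[i]}.
Proof.
rewrite /gen_sym opprD addrCA addrC -polyCB; congr (_%:P - _).
by apply/eqP; rewrite eq_complex/= sub0r opprK !eqxx.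
Qed.

Lemma shift_resolvent s y :
  dom A (mult (res_mult s) y) /\ Defs.shift (0 +i* s) A (mult (res_mult s) y) = y.
Proof.
set x : X := mult (res_mult s) y.
suff [dx Ax] : dom A x /\ A x = (0 +i* s) *: x - y.
  by split; last rewrite -[LHS]/((0 +i* s) *: x - A x) Ax opprB addrCA subrr addr0.
apply/generatorP => n; rewrite c0valB c0valZ.
have -> : gen_sym (N n) = (0 +i* s)%:P - ((omega s n)%:P - 'X).
  by rewrite omegaE opprB addrCA subrr addr0.
rewrite mulrBl take_polyB mul_polyC take_polyZ take_c0; congr (_ - _).
by rewrite multE take_poly_mulr mulrA -take_poly_mull res_symK ?omega_neq0//
  take_poly_mull mul1r take_c0.
Qed.

Lemma shift_inj s x y : dom A x -> Defs.shift (0 +i* s) A x = y -> x = mult (res_mult s) y.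
Proof.
move=> dx sx; have /generatorP Ax := conj dx (erefl (A x)).
apply: c0_eqP => n; rewrite multE -sx -[Defs.shift _ _ _]/((0 +i* s) *: x - A x) c0valB c0valZ Ax.
rewrite -{2}[x n]take_c0 -take_polyZ -take_polyB take_poly_mulr -mul_polyC -mulrBl.
rewrite -omegaE mulrA [res_sym _ _ * _]mulrC -take_poly_mull res_symK ?omega_neq0//.
by rewrite take_poly_mull mul1r take_c0.
Qed.

Lemma resolventE s : resolvent (0 +i* s) A = mult (res_mult s).
Proof.
apply/funext => y; have [dv sv] := shift_resolvent s y.
have [dx sx] := @xgetPex _ (0 : X)
  [set x | dom (Defs.shift (0 +i* s) A) x /\ Defs.shift (0 +i* s) A x = y]
  (ex_intro _ _ (conj dv sv)).
exact: shift_inj dx sx.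
Qed.

Lemma imaginary_axis_resolvent s : resolvent_set A (0 +i* s).
Proof.
split; last first.
  by rewrite resolventE (le_lt_trans (opnorm_res_mult s))// ltry.
split=> //.
- move=> x y /[!inE] dx dy sxy.
  exact: etrans (shift_inj dx sxy) (esym (shift_inj dy (erefl _))).
- by move=> y _; have [dv sv] := shift_resolvent s y; exists (mult (res_mult s) y).
Qed.

Lemma inverse_generatorP y n :
  y n = take_poly (K n) (gen_sym (N n) * inverse A y n).
Proof.
have [dv sv] := shift_resolvent 0 (- y).
have [|dx Ax] := @xgetPex _ (0 : X) [set x | dom A x /\ A x = y].
  exists (mult (res_mult 0) (- y)); split=> //; apply: oppr_inj; rewrite -[RHS]sv.
  rewrite -[RHS]/((0 +i* 0) *: _ - A _).
  by rewrite (_ : 0 +i* 0 = 0)// scale0r add0r.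
exact: (proj1 (generatorP _ _) (conj dx Ax) n).
Qed.

End Semigroup.

(** * A parabolic bump transported by the Poisson semigroup *)

Section Bump.
Context {R : realType}.
Implicit Types (t u N : R) (j k m W K : nat).

Definition bumpc W k : R :=
  if (k <= W.*2)%N then 1 - ((k%:R - W%:R) / W%:R) ^+ 2 else 0.

Definition bump W : {poly R[i]} := \poly_(k < W.*2.+1) (bumpc W k)%:C.

Lemma coef_bump W k : (bump W)`_k = (bumpc W k)%:C.
Proof. by rewrite coef_poly ltnS /bumpc; case: (k <= W.*2)%N. Qed.

Lemma bumpc_ge W k : (0 < W)%N -> 1 - ((k%:R - W%:R) / W%:R) ^+ 2 <= bumpc W k.
Proof.
move=> W0; have W0' : 0 < W%:R :> R by rewrite ltr0n.
rewrite /bumpc; case: leqP => // kW; rewrite subr_le0.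
rewrite exprn_ege1// ler_pdivlMr// mul1r lerBrDr -natrD ler_nat.
by rewrite addnn ltnW.
Qed.

Lemma bumpc_ge0 W k : (0 < W)%N -> 0 <= bumpc W k.
Proof.
move=> W0; have W0' : 0 < W%:R :> R by rewrite ltr0n.
rewrite /bumpc; case: leqP => // kW; rewrite subr_ge0.
have kW' : k%:R <= W%:R + W%:R :> R by rewrite -natrD ler_nat addnn.
have k0 : 0 <= k%:R :> R by rewrite ler0n.
rewrite expr_div_n ler_pdivrMr ?exprn_gt0// mul1r; nra.
Qed.

Lemma bumpc_le1 W k : bumpc W k <= 1.
Proof. by rewrite /bumpc; case: ifP => _; rewrite ?ler01// lerBlDr lerDl sqr_ge0. Qed.

Lemma exp_moment1 t m :
  \sum_(j < m.+1) j%:R * exp_coeff t j = t * \sum_(j < m) exp_coeff t j.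
Proof.
rewrite big_ord_recl mul0r add0r mulr_sumr; apply: eq_bigr => j _.
by rewrite exp_coeffS.
Qed.

Lemma exp_moment2 t m : \sum_(j < m.+2) j%:R * (j%:R - 1) * exp_coeff t j =
  t ^+ 2 * \sum_(j < m) exp_coeff t j.
Proof.
rewrite big_ord_recl !mul0r add0r expr2 -mulrA -exp_moment1 mulr_sumr.
apply: eq_bigr => j _; rewrite -[lift _ _ : nat]/j.+1.
by rewrite mulrAC exp_coeffS -[j.+1%:R]natr1 addrK mulrC mulrCA [X in t * X]mulrC.
Qed.

(** Chebyshev's inequality for the Poisson distribution: the convolution is
bounded from below by the mean of a concave parabola, which only involves the
first two moments. *)
Lemma poisson_bump_ge t W k : 0 <= t -> (0 < W)%N ->
  1 - ((t - (k%:R - W%:R)) ^+ 2 + t) / W%:R ^+ 2 <=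
  expR (- t) * \sum_(j < k.+1) exp_coeff t j * bumpc W (k - j)%N.
Proof.
move=> t0 W0; have W0' : 0 < W%:R :> R by rewrite ltr0n.
rewrite expRN ler_pdivlMl ?expR_gt0//.
set S := \sum_(j < _) _; pose u : R := k%:R - W%:R.
pose P m := \sum_(j < m) exp_coeff t j.
(* the mean of the parabola, restricted to the values below [m.+2] *)
pose g m := P m.+2 - (t ^+ 2 * P m + (1 - 2 * u) * (t * P m.+1) + u ^+ 2 * P m.+2) / W%:R ^+ 2.
have gE m : g m = \sum_(j < m.+2) exp_coeff t j * (1 - ((u - j%:R) / W%:R) ^+ 2).
  rewrite /g -exp_moment2 -exp_moment1 /P !mulr_sumr -!big_split/= mulr_suml.
  rewrite -sumrB; apply: eq_bigr => j _; field.
  by rewrite gt_eqF.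
have g_le m : (k <= m)%N -> g m <= S.
  move=> km; rewrite gE /S (big_ord_widen m.+2
    (fun j => exp_coeff t j * bumpc W (k - j)%N)) ?ltnS 1?ltnW//.
  rewrite [leRHS]big_mkcond/=; apply: ler_sum => j _; case: ifPn => jk.
    rewrite ler_wpM2l ?exp_coeff_ge0// (le_trans _ (bumpc_ge _ W0))//.
    by rewrite natrB// /u addrAC.
  rewrite mulr_ge0_le0 ?exp_coeff_ge0// subr_le0 expr_div_n.
  have jk' : k%:R <= j%:R :> R by rewrite ler_nat ltnW// ltnNge -ltnS.
  by rewrite ler_pdivlMr ?exprn_gt0// mul1r /u; nra.
have Pcvg : P m @[m --> \oo] --> expR t by exact: expR_series_cvg.
have PScvg i : P (m + i)%N @[m --> \oo] --> expR t by rewrite (cvg_shiftn i).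
have gcvg : g m @[m --> \oo] --> expR t * (1 - ((t - u) ^+ 2 + t) / W%:R ^+ 2).
  rewrite (_ : expR t * _ = expR t -
    (t ^+ 2 * expR t + (1 - 2 * u) * (t * expR t) + u ^+ 2 * expR t) / W%:R ^+ 2);
    last by ring.
  apply: cvgB; first by have := PScvg 2; under eq_fun do rewrite addn2.
  apply: cvgMr_tmp; apply: cvgD; last first.
    by apply: cvgMl_tmp; have := PScvg 2; under eq_fun do rewrite addn2.
  apply: cvgD; first exact: cvgMl_tmp.
  apply: cvgMl_tmp; apply: cvgMl_tmp.
  by have := PScvg 1; under eq_fun do rewrite addn1.
apply: (cvgr_to_le gcvg).
by near=> m; apply: g_le; near: m; exact: nbhs_infty_ge.
Unshelve. all: by end_near. Qed.

(** At time [t] the bump, initially centred at [W], is centred near [W + t], the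
spread [sqrt t] being smaller than its width. *)
Lemma maxnorm_sg_sym_bump K N t W : 0 <= t -> (0 < W)%N ->
  t + W%:R + 1 <= K%:R -> 2 * (t + 1) <= W%:R ^+ 2 ->
  2^-1 <= maxnorm K (sg_sym K N t * bump W).
Proof.
move=> t0 W0 tK tW; pose k := (W + Num.truncn t)%N.
have /andP[kt tk] := truncn_itv t0.
have kK : (k < K)%N.
  rewrite -(ltr_nat R) natrD addrC (lt_le_trans _ tK)// (@le_lt_trans _ _ (t + W%:R))//.
    by rewrite lerD2r.
  by rewrite ltrDl.
rewrite (le_trans _ (maxnorm_coef _ kK))//.
rewrite coefM (eq_bigr (fun j : 'I_k.+1 => cis (N * t) *
    (expR (- t) * (exp_coeff t j * bumpc W (k - j)%N))%:C)); last first.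
  move=> j _; have jK : (j < K)%N by rewrite (leq_ltn_trans _ kK)// -ltnS.
  by rewrite coef_poly jK coef_bump /sg_coef !rmorphM/=; ring.
rewrite -mulr_sumr -rmorph_sum cabsM cabs_cis mul1r cabs_real -mulr_sumr.
rewrite (le_trans _ (ler_norm _))// (le_trans _ (poisson_bump_ge _ t0 W0))//.
have W0' : 0 < W%:R :> R by rewrite ltr0n.
rewrite lerBrDr -lerBrDl ler_pdivrMr ?exprn_gt0// natrD addrAC subrr add0r.
have : (t - (Num.truncn t)%:R) ^+ 2 <= 1.
  by move: tk; rewrite -natr1 => tk; nra.
lra.
Qed.

Lemma bnorm_bump (M : R) K W : 0 < M -> (0 < W)%N ->
  bnorm K (wt M K) (bump W) <= 1 + (W.*2.+1)%:R * (1 + M^-1) ^+ K / M.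
Proof.
move=> M0 W0; rewrite lerD//.
  apply: maxnorm_le => // k _; rewrite coef_bump cabs_real ger0_norm ?bumpc_ge0//.
  exact: bumpc_le1.
have r1 : 1 <= 1 + M^-1 by rewrite lerDl invr_ge0 ltW.
have c0 : 0 <= (1 + M^-1) ^+ K / M by rewrite divr_ge0 ?exprn_ge0 ?(ltW M0) ?(le_trans ler01 r1).
rewrite -mulrA /wnorm.
rewrite (@le_trans _ _ (\sum_(k < K) if (k < W.*2.+1)%N then (1 + M^-1) ^+ K / M else 0))//.
  apply: ler_sum => k _; rewrite coef_poly; case: ifP => _; last by rewrite cabs0 mulr0.
  rewrite cabs_real (ger0_norm (bumpc_ge0 _ W0)) -[leRHS]mulr1 ler_pM ?bumpc_ge0 ?bumpc_le1//.
  rewrite ger0_norm ?wt_ge0// /wt ler_wpM2r ?invr_ge0 ?(ltW M0)//.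
  by rewrite ler_weXn2l// leq_subr.
have sumE n : \sum_(k < n) (if (k < W.*2.+1)%N then (1 + M^-1) ^+ K / M else 0) =
    (minn n W.*2.+1)%:R * ((1 + M^-1) ^+ K / M).
  elim: n => [|n IHn]; first by rewrite big_ord0 min0n mul0r.
  rewrite big_ord_recr/= IHn; case: ltnP => nW.
    by rewrite (minn_idPl nW) -natr1 mulrDl mul1r.
  by rewrite addr0 (minn_idPr (leqW nW)).
by rewrite sumE ler_wpM2r// ler_nat geq_minr.
Qed.

End Bump.

(** * The scales of a block *)

Section Scales.
Context {R : realType}.
Variable q : nat.
Hypothesis q3 : (3 <= q)%N.
Implicit Types t : R.

(** The length [K = q M] is a small multiple of [M ln M], so that the weights in the
block do not exceed [e^q / M]. The width [W = M^(5/8)] is larger than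
[sqrt K], the spread of the Poisson distribution, and so much smaller than [M] that
the bump has bounded norm. *)
Definition scaleM : nat := 2 ^ (8 * q).
Definition scaleW : nat := 2 ^ (5 * q).
Definition scaleK : nat := q * scaleM.

(* All scales are powers of [a], up to the factor [q]. *)
Let a : R := 2 ^+ q.

Let a8 : 8 <= a.
Proof.
rewrite (_ : 8 = 2 ^+ 3 :> R); last by rewrite !exprS expr0; lra.
by rewrite /a ler_weXn2l// ler1n.
Qed.

Let qa : q%:R + 1 <= a.
Proof. by rewrite natr1 /a -natrX ler_nat ltn_expl. Qed.

Let q3R : 3 <= q%:R :> R.
Proof. by rewrite ler_nat. Qed.

Let ME : scaleM%:R = a ^+ 8.
Proof. by rewrite /scaleM /a -exprM mulnC natrX. Qed.

Let WE : scaleW%:R = a ^+ 5.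
Proof. by rewrite /scaleW /a -exprM mulnC natrX. Qed.

Let a5_ge1 : 1 <= a ^+ 5.
Proof. by rewrite exprn_ege1// (le_trans _ a8)// ler1n. Qed.

Let a8_ge : 512 * a ^+ 5 <= a ^+ 8.
Proof.
rewrite (_ : a ^+ 8 = a ^+ 3 * a ^+ 5); last by rewrite -exprD.
rewrite ler_wpM2r//; first by rewrite (le_trans ler01).
rewrite (_ : 512 = 8 ^+ 3 :> R); last by rewrite !exprS expr0; lra.
by apply: lerXn2r; rewrite ?nnegrE ?(le_trans _ a8).
Qed.

Lemma scaleM_gt0 : 0 < scaleM%:R :> R.
Proof. by rewrite ltr0n expn_gt0. Qed.

Lemma scaleW_gt0 : (0 < scaleW)%N.
Proof. by rewrite expn_gt0. Qed.

Lemma scaleM_ge1 : 1 <= scaleM%:R :> R.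
Proof. by rewrite ler1n expn_gt0. Qed.

Let qa8 : 3 * a ^+ 8 <= q%:R * a ^+ 8.
Proof. by rewrite ler_wpM2r// -ME ltW// scaleM_gt0. Qed.

Local Ltac scale_lra := have := a8; have := qa; have := q3R; have := a5_ge1;
  have := a8_ge; have := qa8; lra.
Local Ltac scale_nra := have := a8; have := qa; have := q3R; nra.

Lemma size_bump_scale : (size (bump scaleW : {poly R[i]}) <= scaleK)%N.
Proof.
rewrite (leq_trans (size_poly _ _))// -(ler_nat R) -addn1 natrD -addnn natrD.
by rewrite /scaleK natrM ME WE; scale_lra.
Qed.

Lemma expR1_le4 : expR 1 <= 4 :> R.
Proof.
have e2 : expR 2^-1 <= 2 :> R.
  have := expRN_ge (2^-1 : R); rewrite expRN => h.
  have hp : 0 < expR (2^-1 : R) by exact: expR_gt0.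
  rewrite -[leLHS]invrK -[leRHS]invrK lef_pV2 ?posrE ?invr_gt0//.
  by rewrite (le_trans _ h)//; lra.
rewrite (_ : 1 = 2%:R * 2^-1); last by rewrite divff.
rewrite expRM_natl (@le_trans _ _ (2 ^+ 2))//; last by rewrite expr2; lra.
by apply: lerXn2r; rewrite ?nnegrE ?expR_ge0.
Qed.

Lemma bnorm_bump_scale :
  bnorm scaleK (wt scaleM%:R scaleK) (bump scaleW : {poly R[i]}) <= 2.
Proof.
rewrite (le_trans (bnorm_bump _ scaleM_gt0 scaleW_gt0))//.
rewrite (_ : 2 = 1 + 1)// lerD2l ler_pdivrMr ?scaleM_gt0// mul1r.
have hK : (1 + scaleM%:R^-1 : R) ^+ scaleK <= a ^+ 2.
  rewrite (@le_trans _ _ (expR (scaleM%:R^-1) ^+ scaleK))//.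
    apply: lerXn2r; rewrite ?nnegrE ?expR_ge0 ?expR_ge1Dx//.
  rewrite -expRM_natl /scaleK natrM -mulrA mulfV ?gt_eqF ?scaleM_gt0//.
  rewrite expRM_natl (_ : a ^+ 2 = 4 ^+ q).
    by apply: lerXn2r; rewrite ?nnegrE ?expR_ge0 ?expR1_le4.
  by rewrite /a exprAC; congr (_ ^+ _); rewrite expr2; lra.
rewrite (@le_trans _ _ ((3 * a ^+ 5) * a ^+ 2))//.
  rewrite ler_pM ?ler0n ?exprn_ge0 ?addr_ge0 ?invr_ge0//.
  by rewrite -addn1 natrD -addnn natrD WE; scale_lra.
rewrite ME (_ : a ^+ 8 = a * a ^+ 5 * a ^+ 2); last by rewrite -exprS -exprD.
by rewrite !ler_wpM2r ?exprn_ge0 ?(le_trans _ a8)//; scale_lra.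
Qed.

(** The bump is alive on a time interval comparable with [M ln M]. *)
Lemma maxnorm_bump_scale (N : R) t :
  4^-1 * (q%:R * scaleM%:R) <= t <= 2^-1 * (q%:R * scaleM%:R) ->
  2^-1 <= maxnorm scaleK (sg_sym scaleK N t * bump scaleW).
Proof.
rewrite ME => /andP[t1 t2]; apply: maxnorm_sg_sym_bump scaleW_gt0 _ _.
- by rewrite (le_trans _ t1)//; scale_lra.
- by rewrite WE /scaleK natrM ME; scale_lra.
rewrite WE -exprM (_ : a ^+ 10 = a ^+ 2 * a ^+ 8); last by rewrite -exprD.
have h : (q%:R + 2) * a ^+ 8 <= a ^+ 2 * a ^+ 8.
  apply: ler_wpM2r; first by rewrite -ME ltW// scaleM_gt0.
  by rewrite expr2; scale_nra.
by scale_lra.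
Qed.

Lemma ln_le_scale t : 4^-1 * (q%:R * scaleM%:R) <= t <= 2^-1 * (q%:R * scaleM%:R) ->
  0 < ln (t + 2) <= 9 * q%:R.
Proof.
rewrite ME => /andP[t1 t2]; have t0 : 0 <= t by rewrite (le_trans _ t1)//; scale_lra.
apply/andP; split; first by rewrite ln_gt0// ltr_wpDl// ltr1n.
have e2 : 2 <= expR 1 :> R by have := expR_ge1Dx (1 : R); lra.
have h2 : t + 2 <= a ^+ 9.
  have h : q%:R * a ^+ 8 + a ^+ 8 <= a ^+ 9.
    rewrite [a ^+ 9]exprS -[X in _ + X]mul1r -mulrDl ler_wpM2r//.
    by rewrite -ME ltW// scaleM_gt0.
  scale_lra.
rewrite -[9 * _]mulr1 -ler_expR lnK ?posrE ?ltr_wpDl// -natrM expRM_natl.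
rewrite (le_trans h2)// /a -exprM mulnC.
by apply: lerXn2r; rewrite ?nnegrE ?expR_ge0.
Qed.

(** The minimum of the decay bound and of the trivial one is dominated by a single
exponential, whose integral has the order of the lifetime [M ln M]. *)
Lemma decay_le_exp t : 0 <= t ->
  Num.min 1 ((scaleM%:R + 1) * expR (- (t / (scaleM%:R + 1)))) <=
  expR (1 - t / (9 * q%:R * (scaleM%:R + 1))).
Proof.
move=> t0; set M1 : R := scaleM%:R + 1.
have M10 : 0 < M1 by rewrite ltr_wpDl// ler0n.
have l1 : 1 <= 9 * q%:R :> R by scale_lra.
have l0 : 0 < 9 * q%:R :> R by scale_lra.
set r := t / (9 * q%:R * M1).
have tE : t / M1 = 9 * q%:R * r.
  by rewrite /r; field; rewrite !gt_eqF// (lt_le_trans _ q3R).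
have [r1|r1] := leP r 1.
  by rewrite ge_min -[X in X <= _]expR0 ler_expR subr_ge0 r1.
rewrite ge_min; apply/orP; right; rewrite tE.
have e2 : 2 <= expR 1 :> R by have := expR_ge1Dx (1 : R); lra.
rewrite (@le_trans _ _ (expR (9 * q%:R) * expR (- (9 * q%:R * r))))//.
  rewrite ler_wpM2r ?expR_ge0// (@le_trans _ _ (a ^+ 9))//.
    rewrite /M1 ME [a ^+ 9]exprS.
    have : 1 <= a ^+ 8 by rewrite -ME scaleM_ge1.
    scale_nra.
  rewrite -[9 * _]mulr1 -natrM expRM_natl /a -exprM mulnC.
  by apply: lerXn2r; rewrite ?nnegrE ?expR_ge0.
by rewrite -expRD ler_expR; scale_nra.
Qed.

End Scales.

(** * Integrals *)

Section Integrals.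
Context {R : realType}.

(** The integral of a nonnegative function is the supremum of the integrals of the
simple functions below it, hence monotone on arbitrary functions. *)
Lemma le_integral_ge0 d (U : measurableType d) (mu : {measure set U -> \bar R})
    (f g : U -> \bar R) : (forall x, (0 <= f x)%E) -> (forall x, (f x <= g x)%E) ->
  (\int[mu]_x f x <= \int[mu]_x g x)%E.
Proof.
move=> f0 fg; rewrite !ge0_integralTE//; last first.
  by move=> x; exact: le_trans (f0 x) (fg x).
by apply: ereal_sup_le => _ [h /= hf <-]; exists h => // x; exact: le_trans (hf x) (fg x).
Qed.

Lemma le_integral_ge0_in d (U : measurableType d) (mu : {measure set U -> \bar R})
    (D E : set U) (f g : U -> \bar R) : D `<=` E ->
  (forall x, D x -> (0 <= f x)%E) -> (forall x, E x -> (0 <= g x)%E) ->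
  (forall x, D x -> (f x <= g x)%E) ->
  (\int[mu]_(x in D) f x <= \int[mu]_(x in E) g x)%E.
Proof.
move=> DE f0 g0 fg; rewrite integral_mkcond [leRHS]integral_mkcond.
apply: le_integral_ge0 => x; rewrite !patchE.
  by case: ifPn => // /set_mem; exact: f0.
case: ifPn => [/set_mem Dx|_]; first by rewrite mem_set ?fg//; exact: DE.
by case: ifPn => // /set_mem; exact: g0.
Qed.

Lemma integral_exp_series (b r : nat -> R) (B : R) :
  (forall n, 0 <= b n) -> (forall n, 0 < r n) ->
  (forall m, \sum_(n < m) b n <= B) ->
  (\int[lebesgue_measure]_(t in `[0%R, +oo[)
     \sum_(n <oo) (b n * exponential_pdf (r n) t)%:E <= B%:E)%E.
Proof.
move=> b0 r0 hB.
have mpdf n : measurable_fun (`[0%R, +oo[%classic : set R)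
    (fun t : R => (exponential_pdf (r n) t)%:E).
  apply/measurable_EFinP; apply: measurable_funTS; exact: measurable_exponential_pdf.
rewrite integral_nneseries//; last 2 first.
- by move=> n; exact: (measurable_funeM (b n)%:E (mpdf n)).
- by move=> n x _; rewrite lee_fin mulr_ge0// exponential_pdf_ge0// ltW.
have int1 n : (\int[lebesgue_measure]_(t in `[0%R, +oo[%classic)
    (b n * exponential_pdf (r n) t)%:E = (b n)%:E)%E.
  under eq_integral do rewrite EFinM.
  rewrite ge0_integralZl//; last 3 first.
  - exact: mpdf.
  - by move=> x _; rewrite lee_fin exponential_pdf_ge0// ltW.
  - by rewrite lee_fin.
  rewrite integral_mkcond (_ : _ \_ _ = fun t => (exponential_pdf (r n) t)%:E).
    by rewrite integral_exponential_pdf// mule1.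
  apply/funext => t; rewrite patchE; case: ifPn => //; rewrite notin_setE/= => t0.
  rewrite lt0_exponential_pdf// ltNge; apply/negP => t0'; apply: t0.
  by rewrite in_itv/= t0'.
rewrite (eq_eseriesr (fun n _ => int1 n)).
apply: lime_le; first by apply: is_cvg_nneseries => n _ _; rewrite lee_fin.
by near=> m; rewrite sumEFin lee_fin big_mkord.
Unshelve. all: by end_near. Qed.

(** The power of a supremum is at most the sum of the powers. This bounds the norm
in a c_0-sum by a quantity that can be integrated term by term. *)
Lemma powR_le_series (p y : R) (z F : nat -> R) : 0 < p -> 0 <= y ->
  (forall n, 0 <= z n) -> (forall n, z n `^ p <= F n) ->
  (forall b, (forall n, z n <= b) -> y <= b) ->
  ((y `^ p)%:E <= \sum_(n <oo) (F n)%:E)%E.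
Proof.
move=> p0 y0 z0 zF yz; have F0 n : 0 <= F n := le_trans (powR_ge0 _ _) (zF n).
have F0e n : xpredT n -> (0%N <= n)%N -> (0 <= (F n)%:E)%E by rewrite lee_fin.
have le_sum n : ((F n)%:E <= \sum_(n <oo) (F n)%:E)%E.
  rewrite (le_trans _ (nneseries_lim_ge (m := 0%N) (P := xpredT) n.+1 _))//.
    by rewrite big_nat_recr//= leeDr// sume_ge0// => i _; rewrite lee_fin.
case: (\sum_(n <oo) (F n)%:E)%E le_sum => [s| |] le_sum; rewrite ?leey//; last first.
  by have := le_sum 0%N.
rewrite lee_fin.
have s0 : 0 <= s by rewrite (le_trans (F0 0%N))// -lee_fin.
rewrite [leRHS](_ : s = (s `^ p^-1) `^ p); last first.
  by rewrite -powRrM mulVf ?gt_eqF// powRr1.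
apply: ge0_ler_powR; rewrite ?nnegrE ?powR_ge0 ?(ltW p0)//.
apply: yz => n; rewrite [leLHS](_ : z n = (z n `^ p) `^ p^-1); last first.
  by rewrite -powRrM divff ?gt_eqF// powRr1.
apply: ge0_ler_powR; rewrite ?nnegrE ?powR_ge0 ?invr_ge0 ?(ltW p0)//.
by rewrite (le_trans (zF n))// -lee_fin.
Qed.

Lemma powRV (x r : R) : 0 <= x -> x^-1 `^ r = (x `^ r)^-1.
Proof. by move=> x0; rewrite -(powR_inv1 x0) powRAC powR_inv1 ?powR_ge0. Qed.

End Integrals.

(** * The example *)

Section Construction.
Variables (R : realType) (alpha p : R) (gamma : R -> R).
Hypothesis alpha_gt0 : 0 < alpha.
Hypothesis p_ge1 : 1 <= p.
Hypothesis gamma_gt0 : forall t : R, 0 <= t -> 0 < gamma t.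

Let p_gt0 : 0 < p. Proof. exact: lt_le_trans p_ge1. Qed.

(** In block [n] the function [gamma] has to be so small that the [n]-th component of
the vector [f], in spite of the factor [2^-n] in its p-th power, contributes at least
[n.+1] to the divergent integral. *)
Let eps (n : nat) : R := 2^-1 ^+ n * 4^-1 `^ p / (72 * n.+1%:R).

Variable q : nat -> nat.
Hypothesis q3 : forall n, (3 <= q n)%N.
Hypothesis q_alpha : forall n, alpha <= (8 * q n)%:R.
Hypothesis q_gamma : forall n (t : R), (q n)%:R <= t ->
  (36 * gamma t) `^ (p / alpha) <= eps n.

Let M n : R := (scaleM (q n))%:R.
Let K n := scaleK (q n).
Let N n : R := M n `^ alpha^-1.
Local Notation X := (c0sum K (fun n => wt (M n) (K n))).

Let M0 n : 0 < M n. Proof. exact: scaleM_gt0. Qed.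

Let N_ge2 n : 2 <= N n.
Proof.
have -> : 2 = 2 `^ (alpha / alpha) :> R by rewrite divff ?gt_eqF// powRr1.
rewrite powRrM ge0_ler_powR ?nnegrE ?powR_ge0 ?invr_ge0 ?(ltW alpha_gt0) ?(ltW (M0 n))//.
by rewrite /M /scaleM natrX -powR_mulrn// ler_powR// ?q_alpha// ler1n.
Qed.

Let N0 n : 0 <= N n. Proof. exact: powR_ge0. Qed.

Let NE n : N n `^ alpha = M n.
Proof. by rewrite -powRrM mulVf ?gt_eqF// powRr1// ltW. Qed.

Let MN n : M n <= N n `^ alpha. Proof. by rewrite NE. Qed.

Let sg : R -> {linear X -> X} := poisson_sg K N M0.

(** A time constant for the decay of block [n], of order [M n * ln (M n)]. *)
Let tau n : R := 9 * (q n)%:R * (M n + 1).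

Let tau_gt0 n : 0 < tau n.
Proof.
rewrite !mulr_gt0// ?addr_gt0 ?M0// ltr0n; exact: leq_ltn_trans (q3 n).
Qed.

Let tau_ge1 n : 1 <= tau n.
Proof.
have q3R : 3 <= (q n)%:R :> R by rewrite ler_nat q3.
have M1 := scaleM_ge1 (R := R) (q n).
rewrite -[1]mulr1 ler_pM//; lra.
Qed.

(* The p-th power of the coefficient of block [n]: the factor [1 / tau n] compensates
the lifetime of the block and [2^-n] makes the integral (b) converge. *)
Let d n : R := 2^-1 ^+ n / tau n.

Let c n : R := d n `^ p^-1.

Let d_ge0 n : 0 <= d n.
Proof. by rewrite divr_ge0 ?exprn_ge0 ?invr_ge0 ?(ltW (tau_gt0 n)). Qed.

Let c_ge0 n : 0 <= c n. Proof. exact: powR_ge0. Qed.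

Let cE n : c n `^ p = d n.
Proof. by rewrite -powRrM mulVf ?gt_eqF// powRr1. Qed.

Let fmem : (fun n => (c n)%:C *: bump (scaleW (q n)) : {poly R[i]})
  \in c0mem K (fun n => wt (M n) (K n)).
Proof.
apply/asboolP; split=> [n|].
  by rewrite (leq_trans (size_scale_leq _ _))// size_bump_scale.
pose r : R := 2^-1 `^ p^-1.
have r1 : `|r| < 1.
  rewrite ger0_norm ?powR_ge0// [ltRHS](_ : 1 = 1 `^ p^-1); last by rewrite powR1.
  rewrite gt0_ltr_powR ?nnegrE ?invr_ge0 ?invr_gt0//.
  by rewrite invf_lt1// ltr1n.
apply: (@squeeze_cvgr _ _ _ _ (fun=> 0) (fun n => 2 * r ^+ n)).
- apply: nearW => n; rewrite blk_ge0/= mulrC.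
  have [_ bZ _] := seminorm_bnorm (K n) (wt (M n) (K n)).
  rewrite /blk bZ cabs_real ger0_norm// ler_pM ?bnorm_ge0 ?bnorm_bump_scale//.
  rewrite /c /r -powR_mulrn ?powR_ge0// powRAC powR_mulrn ?invr_ge0//.
  rewrite ge0_ler_powR ?nnegrE ?exprn_ge0 ?invr_ge0 ?(ltW p_gt0)//.
  by rewrite /d ler_pdivrMr// ler_peMr ?exprn_ge0 ?invr_ge0.
- exact: cvg_cst.
- by rewrite -(mulr0 2); apply: cvgMl_tmp; exact: cvg_expr.
Qed.

Let f : X := C0Sum fmem.

Let blk_S_le t n : 0 <= t -> blk K (fun n => wt (M n) (K n)) (sg t f) n <=
  2 * c n * Num.min 1 ((M n + 1) * expR (- (t / (M n + 1)))).
Proof.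
move=> t0; have [_ bZ bT] := seminorm_bnorm (K n) (wt (M n) (K n)).
rewrite /blk poisson_sg_coord// bT -scalerAr bZ cabs_real ger0_norm// -mulrA mulrCA.
rewrite ler_wpM2l//; have hb := bnorm_bump_scale (R := R) (q3 n).
rewrite /Num.min; case: ifP => _.
  by rewrite mulr1 (le_trans _ hb)//; exact: bnorm_sg_sym.
rewrite (le_trans (bnorm_sg_sym_decay (K n) (M0 n) (N n) (bump (scaleW (q n))) t0))// mulrC ler_wpM2r//.
by rewrite mulr_ge0 ?expR_ge0 ?addr_ge0 ?(ltW (M0 n)).
Qed.

Let integral_f :
  (\int[lebesgue_measure]_(t in `[0%R, +oo[) ((rnorm (sg t f)) `^ p)%:E < +oo)%E.
Proof.
pose b n : R := 2 `^ p * expR 1 * 2^-1 ^+ n.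
have b0 n : 0 <= b n by rewrite !mulr_ge0 ?powR_ge0 ?expR_ge0// exprn_ge0 ?invr_ge0.
have tV n : 0 < (tau n)^-1 by rewrite invr_gt0.
apply: (@le_lt_trans _ _ (\int[lebesgue_measure]_(t in `[0%R, +oo[)
    \sum_(n <oo) (b n * exponential_pdf (tau n)^-1 t)%:E)%E); last first.
  apply: (le_lt_trans (integral_exp_series (B := 2 `^ p * expR 1 * 2) b0 tV _)).
    move=> m; rewrite -mulr_sumr ler_wpM2l ?mulr_ge0 ?powR_ge0 ?expR_ge0//.
    have h0 : 0 <= 2^-1 :> R by rewrite invr_ge0.
    have h1 : 2^-1 < 1 :> R by rewrite invf_lt1// ltr1n.
    by rewrite (le_trans (geometric_le m h0 h1))// [X in X - _]splitr div1r addrK invrK.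
  by rewrite ltry.
have pdf0 n t : 0 <= exponential_pdf (tau n)^-1 t by rewrite exponential_pdf_ge0// ltW.
apply: le_integral_ge0_in => //.
- by move=> t _; rewrite lee_fin powR_ge0.
- by move=> t _; apply: nneseries_ge0 => n _ _; rewrite lee_fin mulr_ge0.
move=> t; rewrite /= in_itv/= andbT => t0.
apply: (@powR_le_series _ _ _ (fun n => blk K (fun n => wt (M n) (K n)) (sg t f) n)) => //.
- exact: c0norm_ge0.
- by move=> n; exact: blk_ge0.
- move=> n; cbv beta; set m := Num.min 1 ((M n + 1) * expR (- (t / (M n + 1)))).
  have m0 : 0 <= m.
    by rewrite le_min ler01 mulr_ge0 ?expR_ge0 ?addr_ge0 ?(ltW (M0 n)).
  apply: (@le_trans _ _ ((2 * c n * m) `^ p)).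
    by rewrite ge0_ler_powR ?nnegrE ?blk_ge0 ?mulr_ge0 ?blk_S_le// ltW.
  rewrite !powRM ?mulr_ge0// cE.
  have mp : m `^ p <= expR (1 - t / tau n).
    apply: le_trans (decay_le_exp (q3 n) t0); rewrite -/m.
    have [->|mN0] := eqVneq m 0; first by rewrite powR0 ?gt_eqF.
    by rewrite ge1r_powR// lt_neqAle eq_sym mN0 m0/= ge_min lexx.
  rewrite (le_trans (ler_wpM2l (mulr_ge0 (powR_ge0 _ _) (d_ge0 n)) mp))//.
  rewrite exponential_pdfE// /b /d expRD mulNr [_^-1 * t]mulrC.
  by rewrite -subr_ge0 (_ : _ - _ = 0)//; ring.
- by move=> y hy; exact: c0norm_le.
Qed.

Let A := generator sg.

(** The orbit of [f] in block [n] is the image of the orbit of [A^-1 f] under an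
operator of norm at most [N n + 2] for the maximum norm. *)
Let rnorm_ge t n : 4^-1 * ((q n)%:R * M n) <= t <= 2^-1 * ((q n)%:R * M n) ->
  c n / (4 * N n) <= rnorm (sg t (inverse A f)).
Proof.
move=> ht; have t0 : 0 <= t.
  by case/andP: ht => h _; rewrite (le_trans _ h)// !mulr_ge0 ?invr_ge0.
have hm := maxnorm_bump_scale (q3 n) (N n) ht.
have [_ mZ mT] := seminorm_maxnorm (R := R) (K n).
set g := inverse A f.
have fE : f n = take_poly (K n) (gen_sym (N n) * g n).
  exact: (inverse_generatorP M0 N0 (ltW alpha_gt0) MN).
have NN : 0 < N n by rewrite (lt_le_trans _ (N_ge2 n)).
rewrite ler_pdivrMr ?mulr_gt0// (@le_trans _ _ (2 * maxnorm (K n) (sg_sym (K n) (N n) t * f n)))//.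
  rewrite /= -scalerAr mZ cabs_real ger0_norm// mulrCA -[leLHS]mulr1 ler_wpM2l//.
  by rewrite mulrC -ler_pdivrMr// div1r.
rewrite fE -mT take_poly_mulr mT mulrCA.
rewrite (@le_trans _ _ (2 * ((N n + 2) * maxnorm (K n) (sg_sym (K n) (N n) t * g n))))//.
  rewrite ler_wpM2l// (le_trans (maxnorm_mul _ _ _))// ler_wpM2r ?maxnorm_ge0//.
  exact: l1norm_gen_sym.
have hg : maxnorm (K n) (sg_sym (K n) (N n) t * g n) <= rnorm (sg t g).
  rewrite -mT -poisson_sg_coord// (le_trans (maxnorm_le_bnorm _ (wt (M n) (K n)) _))//.
  exact: (blk_le_c0norm (sg t g) n).
have := maxnorm_ge0 (R := R) (K n) (sg_sym (K n) (N n) t * g n).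
by have := N_ge2 n; nra.
Qed.

Let weight_ge t n : 4^-1 * ((q n)%:R * M n) <= t <= 2^-1 * ((q n)%:R * M n) ->
  N n `^ p / eps n <= (t / (gamma t * ln (t + 2))) `^ (p / alpha).
Proof.
move=> ht; have /andP[l0 l1] := ln_le_scale (q3 n) ht.
have q3R : 3 <= (q n)%:R :> R by rewrite ler_nat q3.
have M4 : 4 <= M n.
  rewrite (_ : 4 = 4%:R :> R)// /scaleM ler_nat (@leq_trans (2 ^ 2))//.
  by rewrite leq_pexp2l//; have := q3 n; lia.
have qt : (q n)%:R <= t by case/andP: ht => h _; rewrite (le_trans _ h)//; nra.
have t0 : 0 <= t by rewrite (le_trans _ qt).
have g0 := gamma_gt0 t0.
have e0 : 0 < (36 * gamma t) `^ (p / alpha) by rewrite powR_gt0// mulr_gt0.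
rewrite (@le_trans _ _ (N n `^ p / (36 * gamma t) `^ (p / alpha)))//.
  rewrite ler_wpM2l ?powR_ge0// lef_pV2 ?posrE ?q_gamma//.
  exact: lt_le_trans (q_gamma qt).
have -> : N n `^ p = M n `^ (p / alpha) by rewrite -powRrM mulrC.
have Mg0 : 0 <= 36 * gamma t by rewrite mulr_ge0// ltW.
rewrite -powRV// -powRM ?invr_ge0 ?(ltW (M0 n))//.
rewrite ge0_ler_powR ?nnegrE ?divr_ge0 ?(mulr_ge0 (ltW g0) (ltW l0)) ?(ltW p_gt0)
  ?(ltW alpha_gt0) ?(ltW (M0 n))//.
rewrite ler_pdivrMr ?mulr_gt0// mulrAC ler_pdivlMr ?mulr_gt0//.
case/andP: ht => h _.
have h1 : M n * ln (t + 2) <= M n * (9 * (q n)%:R) by rewrite ler_wpM2l ?(ltW (M0 n)).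
by nra.
Qed.

(** A single block already contributes more than any given bound. *)
Let integral_inverse_f :
  (\int[lebesgue_measure]_(t in `[0%R, +oo[)
     ((rnorm (sg t (inverse A f))) `^ p *
      (t / (gamma t * ln (t + 2))) `^ (p / alpha))%:E = +oo)%E.
Proof.
apply/eqyP => B B0; pose n := Num.truncn B.
pose t1 : R := 4^-1 * ((q n)%:R * M n); pose t2 : R := 2^-1 * ((q n)%:R * M n).
pose x : R := d n * 4^-1 `^ p / eps n.
have e0 : 0 < eps n.
  by rewrite divr_gt0 ?mulr_gt0 ?powR_gt0 ?exprn_gt0 ?invr_gt0.
have NN : 0 < N n by rewrite (lt_le_trans _ (N_ge2 n)).
have q3R : 3 <= (q n)%:R :> R by rewrite ler_nat q3.
have qM0 : 0 < (q n)%:R * M n by rewrite mulr_gt0 ?M0// (lt_le_trans _ q3R).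
have x0 : 0 <= x.
  apply: divr_ge0; last exact: ltW.
  by apply: mulr_ge0; [exact: d_ge0|exact: powR_ge0].
have t12 : t1 < t2 by rewrite /t1 /t2; lra.
apply: (@le_trans _ _ (\int[lebesgue_measure]_(t in `[t1, t2]) (cst x%:E t))%E); last first.
  apply: le_integral_ge0_in => [t|t _|t _|t].
  - rewrite /= !in_itv/= andbT => /andP[h _].
    by rewrite (le_trans _ h)// mulr_ge0 ?invr_ge0// ltW.
  - by rewrite lee_fin.
  - by rewrite lee_fin mulr_ge0 ?powR_ge0.
  rewrite /= in_itv/= => ht; rewrite lee_fin.
  have -> : x = (c n / (4 * N n)) `^ p * (N n `^ p / eps n).
    rewrite invfM mulrA !powRM ?mulr_ge0 ?invr_ge0 ?(ltW NN)// cE /x.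
    rewrite (powRV _ (ltW NN)).
    by field; rewrite !gt_eqF// powR_gt0.
  rewrite ler_pM ?powR_ge0 ?weight_ge ?divr_ge0 ?powR_ge0 ?(ltW e0)//.
  rewrite ge0_ler_powR ?nnegrE ?rnorm_ge ?divr_ge0 ?mulr_ge0 ?(ltW NN) ?(ltW p_gt0)//.
  exact: c0norm_ge0.
have mu_t12 : lebesgue_measure (`[t1, t2]%classic : set R) = (t2 - t1)%:E.
  by rewrite lebesgue_measure_itv/= lte_fin t12 EFinB.
rewrite integral_cst// [X in (_ * X)%E]mu_t12 -EFinM lee_fin.
rewrite (@le_trans _ _ n.+1%:R)//; first by rewrite ltW// truncnS_gt.
have -> : x = d n / 2^-1 ^+ n * (72 * n.+1%:R).
  have u0 : 2^-1 ^+ n != 0 :> R by rewrite expf_neq0// invr_neq0.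
  have v0 : 4^-1 `^ p != 0 :> R by rewrite gt_eqF// powR_gt0// invr_gt0.
  have m0 : n.+1%:R != 0 :> R by rewrite pnatr_eq0.
  rewrite /x /eps; move: u0 v0 m0 (d n).
  move: (_ ^+ n) (_ `^ p) (n.+1%:R) => u v m u0 v0 m0 y; field.
  by rewrite u0 v0 m0.
have -> : d n / 2^-1 ^+ n = (tau n)^-1.
  by rewrite /d mulrAC divff ?mul1r// gt_eqF// exprn_gt0// invr_gt0.
have -> : t2 - t1 = 4^-1 * ((q n)%:R * M n) by rewrite /t2 /t1; lra.
rewrite mulrAC -mulrA ler_pdivlMl ?tau_gt0// mulrC.
have M1 := scaleM_ge1 (R := R) (q n).
have n1 : 0 < n.+1%:R :> R by rewrite ltr0n.
rewrite [leRHS](_ : _ = n.+1%:R * (18 * ((q n)%:R * M n))); last by field.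
by rewrite ler_wpM2l ?(ltW n1)// /tau; nra.
Qed.

Lemma block_sum_example :
  exists (X : completeNormedModType R[i]) (T : R -> {linear X -> X}) (f : X),
    let A := generator T in
    C0_semigroup T /\ bounded_semigroup T /\
    (spectrum A `&` imaginary_axis = set0 /\
     exists K s0 : R, forall s : R, s0 <= `|s| ->
       (opnorm (resolvent (0%R +i* s)%C A) <= (K * (`|s| `^ alpha))%:E)%E) /\
    (\int[lebesgue_measure]_(t in `[0%R, +oo[) ((rnorm (T t f)) `^ p)%:E
       < +oo)%E /\
    (\int[lebesgue_measure]_(t in `[0%R, +oo[)
       ((rnorm (T t (inverse A f))) `^ p *
        (t / (gamma t * ln (t + 2))) `^ (p / alpha))%:E = +oo)%E.
Proof.
exists X, sg, f; split; first exact: poisson_sg_C0.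
split; first by exists 1 => t _; exact: opnorm_poisson_sg.
split; last by split; [exact: integral_f|exact: integral_inverse_f].
have a0 := ltW alpha_gt0.
split.
  apply/seteqP; split=> // -[x s] [/= + x0]; rewrite /imaginary_axis/= in x0.
  by rewrite x0; apply; exact: (imaginary_axis_resolvent K M0 N0 a0 MN).
exists (2 * 2 `^ alpha + 1), 2 => s s2.
rewrite (resolventE K M0 N0 a0 MN) (le_trans (opnorm_res_mult K M0 N0 a0 MN s))// lee_fin.
have s1 : 1 <= `|s| `^ alpha.
  rewrite [leLHS](_ : 1 = 1 `^ alpha); last by rewrite powR1.
  rewrite ge0_ler_powR ?nnegrE//.
  by rewrite (le_trans _ s2)// ler1n.
rewrite /res_bound [leRHS]mulrDl mul1r lerD// -mulrA ler_wpM2l// -powRM//.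
rewrite ge0_ler_powR ?nnegrE ?addr_ge0 ?mulr_ge0//.
by rewrite mulrDl mul1r lerD2l.
Qed.

End Construction.

Theorem theorem7p1 (R : realType) (alpha p : R) (gamma : R -> R)
  (alpha_gt0 : 0 < alpha) (p_ge1 : 1 <= p)
  (gamma_C0 : C0_Rplus gamma)
  (gamma_gt0 : forall t : R, 0 <= t -> 0 < gamma t) :
  exists (X : completeNormedModType R[i]) (T : R -> {linear X -> X}) (f : X),
    let A := generator T in
    C0_semigroup T /\ bounded_semigroup T /\
    (* (a) *)
    (spectrum A `&` imaginary_axis = set0 /\
     exists K s0 : R, forall s : R, s0 <= `|s| ->
       (opnorm (resolvent (0%R +i* s)%C A) <= (K * (`|s| `^ alpha))%:E)%E) /\
    (* (b) *)
    (\int[lebesgue_measure]_(t in `[0%R, +oo[) ((rnorm (T t f)) `^ p)%:E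
       < +oo)%E /\
    (* (c) *)
    (\int[lebesgue_measure]_(t in `[0%R, +oo[)
       ((rnorm (T t (inverse A f))) `^ p *
        (t / (gamma t * ln (t + 2))) `^ (p / alpha))%:E = +oo)%E.
Proof.
have p0 : 0 < p := lt_le_trans ltr01 p_ge1.
have r0 : 0 < p / alpha by rewrite divr_gt0.
(* As [gamma] tends to 0, each block can be put at a frequency so high that [gamma] is
small on the time interval where the block contributes to the integral (c). *)
have [q hq] : exists q : nat -> nat, forall n, [/\ (3 <= q n)%N,
    alpha <= (8 * q n)%:R & forall t : R, (q n)%:R <= t ->
    (36 * gamma t) `^ (p / alpha) <= 2^-1 ^+ n * 4^-1 `^ p / (72 * n.+1%:R)].
  suff h n : exists q : nat, [/\ (3 <= q)%N,
      alpha <= (8 * q)%:R & forall t : R, q%:R <= t ->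
      (36 * gamma t) `^ (p / alpha) <= 2^-1 ^+ n * 4^-1 `^ p / (72 * n.+1%:R)].
    by exists (fun n => projT1 (cid (h n))) => n; exact: projT2 (cid (h n)).
  set e := _ / (72 * _); have e0 : 0 < e.
    by rewrite divr_gt0 ?mulr_gt0 ?exprn_gt0 ?powR_gt0 ?invr_gt0.
  pose b := e `^ (p / alpha)^-1 / 36.
  have b0 : 0 < b by rewrite divr_gt0// powR_gt0.
  have [_ /cvgrPdistC_le/(_ b b0)[u [_ hu]]] := gamma_C0.
  pose m := Num.max u alpha; exists (Num.truncn `|m|).+3.
  have mle : m < (Num.truncn `|m|).+3%:R.
    by rewrite (le_lt_trans (ler_norm _))// (lt_trans (truncnS_gt _))// ltr_nat.
  split=> [//||t qt].
    rewrite (@le_trans _ _ m) ?le_max ?lexx ?orbT// (le_trans (ltW mle))//.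
    by rewrite ler_nat leq_pmull.
  have t0 : 0 <= t by rewrite (le_trans _ qt).
  have gb : gamma t <= b.
    have /hu : u < t.
      by rewrite (lt_le_trans _ qt)// (le_lt_trans _ mle)// le_max lexx.
    by rewrite /= subr0 => /(le_trans (ler_norm _)).
  have -> : e = (e `^ (p / alpha)^-1) `^ (p / alpha).
    by rewrite -powRrM mulVf ?gt_eqF// powRr1// ltW.
  rewrite ge0_ler_powR ?nnegrE ?powR_ge0 ?(ltW r0)//.
    by rewrite mulr_ge0// ltW// gamma_gt0.
  by rewrite mulrC -ler_pdivlMr.
by apply: (block_sum_example alpha_gt0 p_ge1 gamma_gt0 (q := q)) => n; have [] := hq n.
Qed.
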